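(* Let $n\ge 0$ and let $p$ be a point of $\mathbb{R}^2\times(S^1)^{n+1}$ with coordinates $\zeta^p=(\xi_1^p,\xi_2^p,\theta_0^p,\ldots,\theta_n^p)$. Let $\phi^n=(x_1,\ldots,x_{n+3})$ be the local diffeomorphism around $p$, and $\nu_n,\eta_n,\mu_n$ the smooth functions around $p$, constructed in the context, and let $\psi^n=(\phi^n)^{-1}$. Then there is a Kumpera-Ruiz normal form $\kappa^{n+3}=(\kappa_1^{n+3},\kappa_2^{n+3})$ on $\mathbb{R}^{n+3}$ such that, in a neighborhood of $\phi^n(\zeta^p)$, $$\phi^n_*(\tau_1^n)=(\nu_n\circ\psi^n)\,\kappa_1^{n+3},\qquad \phi^n_*(\tau_2^n)=(\eta_n\circ\psi^n)\,\kappa_1^{n+3}+(\mu_n\circ\psi^n)\,\kappa_2^{n+3},$$ where $(\tau_1^n,\tau_2^n)$ is the $n$-trailer system. Thus the diffeomorphism $\phi^n$ and the feedback transformation $u_1=\nu_n v_1+\eta_n v_2$, $u_2=\mu_n v_2$ convert the $n$-trailer system $\dot\zeta=\tau_1^n(\zeta)v_1+\tau_2^n(\zeta)v_2$, locally at $p$, into the Kumpera-Ruiz normal form $\dot x=\kappa_1^{n+3}(x)u_1+\kappa_2^{n+3}(x)u_2$.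
   Context: Lifts. A vector field on a space with coordinates $(z_1,\ldots,z_{m-1})$ is lifted to the space with one additional coordinate $z_m$ (and denoted by the same symbol) by keeping the same components (independent of $z_m$) and taking the $\partial/\partial z_m$-component to be $0$. The $n$-trailer system. On $\mathbb{R}^2\times S^1$ with coordinates $(\xi_1,\xi_2,\theta_0)$ let $\tau_1^0=\frac{\partial}{\partial\theta_0}$, $\tau_2^0=\sin(\theta_0)\frac{\partial}{\partial\xi_2}+\cos(\theta_0)\frac{\partial}{\partial\xi_1}$. Inductively, for $n\ge1$, on $\mathbb{R}^2\times(S^1)^{n+1}$ with coordinates $\zeta=(\xi_1,\xi_2,\theta_0,\ldots,\theta_n)$ let $$\tau_1^n=\tfrac{\partial}{\partial\theta_n},\qquad \tau_2^n=\sin(\theta_n-\theta_{n-1})\,\tau_1^{n-1}+\cos(\theta_n-\theta_{n-1})\,\tau_2^{n-1},$$ where $\tau_1^{n-1},\tau_2^{n-1}$ on the right are lifted along $\theta_n$. The pair $\tau^n=(\tau_1^n,\tau_2^n)$ is the $n$-trailer system. Kumpera-Ruiz normal forms. The pair $\kappa^3=(\kappa_1^3,\kappa_2^3)$ on $\mathbb{R}^3$ is $\kappa_1^3=\frac{\partial}{\partial x_3}$, $\kappa_2^3=x_3\frac{\partial}{\partial x_2}+\frac{\partial}{\partial x_1}$. Given a pair $\kappa^{m-1}$ of vector fields on $\mathbb{R}^{m-1}$, its regular prolongation with parameter $c\in\mathbb{R}$, $R_c(\kappa^{m-1})$, is the pair on $\mathbb{R}^m$ given by $\kappa_1^m=\frac{\partial}{\partial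 x_m}$, $\kappa_2^m=(x_m+c)\kappa_1^{m-1}+\kappa_2^{m-1}$; its singular prolongation $S(\kappa^{m-1})$ is given by $\kappa_1^m=\frac{\partial}{\partial x_m}$, $\kappa_2^m=\kappa_1^{m-1}+x_m\kappa_2^{m-1}$ (lifts along $x_m$ understood). For $m\ge3$, a pair $\kappa^m$ on $\mathbb{R}^m$ is a Kumpera-Ruiz normal form if $\kappa^m=\sigma_{m-3}\circ\cdots\circ\sigma_1(\kappa^3)$, where each $\sigma_i$ equals either $S$ or $R_{c_i}$ for some real constant $c_i$. Construction of $\phi^n,\nu_n,\eta_n,\mu_n$. Fix $p$ as in the claim. Write $s_i=\sin(\theta_i-\theta_{i-1})$, $c_i=\cos(\theta_i-\theta_{i-1})$ for $1\le i\le n$, and let $\mathrm{L}_f\alpha$ denote the Lie derivative of a function $\alpha$ along a vector field $f$. Start ($i=0$): if $\theta_0^p\ne\pm\pi/2 \bmod 2\pi$, take $x_1=\xi_1$, $x_2=\xi_2$, $x_3=\tan(\theta_0)$, $\mu_0=\cos(\theta_0)$, $\nu_0=\sec^2(\theta_0)$, $\eta_0=0$. If $\theta_0^p=\pm\pi/2\bmod 2\pi$, take $x_1=\xi_2$, $x_2=\xi_1$, $x_3=\cot(\theta_0)$, $\mu_0=\sin(\theta_0)$, $\nu_0=-\csc^2(\theta_0)$, $\eta_0=0$. For $1\le i\le n$: if $\theta_i^p-\theta_{i-1}^p\neq\pm\pi/2\bmod 2\pi$ (regular case), set $$x_{i+3}=\frac{s_i\nu_{i-1}+c_i\eta_{i-1}}{c_i\mu_{i-1}},\quad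 \mu_i=c_i\mu_{i-1},\quad \nu_i=\mathrm{L}_{\tau_1^i}x_{i+3},\quad \eta_i=\mathrm{L}_{\tau_2^i}x_{i+3};$$ if $\theta_i^p-\theta_{i-1}^p=\pm\pi/2\bmod 2\pi$ (singular case), set $$x_{i+3}=\frac{c_i\mu_{i-1}}{s_i\nu_{i-1}+c_i\eta_{i-1}},\quad \mu_i=s_i\nu_{i-1}+c_i\eta_{i-1},\quad \nu_i=\mathrm{L}_{\tau_1^i}x_{i+3},\quad \eta_i=\mathrm{L}_{\tau_2^i}x_{i+3}.$$ For $0\le i\le n$ put $\phi^i(\xi_1,\xi_2,\theta_0,\ldots,\theta_i)=(x_1,\ldots,x_{i+3})$. With $p_i$ the projection of $p$ on $\mathbb{R}^2\times(S^1)^{i+1}$, these functions are well defined and smooth around $p_i$, each $\phi^i$ is a smooth change of coordinates around $p_i$, and $\nu_i(p_i)\ne0$, $\mu_i(p_i)\neq0$. *)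

(* Defs.v *)
From mathcomp Require Import all_boot all_order all_algebra.
From mathcomp Require Import all_classical all_reals all_analysis.
From mathcomp Require Import ring.

Set Implicit Arguments.
Unset Strict Implicit.
Unset Printing Implicit Defensive.

Import Order.TTheory GRing.Theory Num.Theory.
Import numFieldNormedType.Exports.

Local Open Scope classical_set_scope.
Local Open Scope ring_scope.

Definition vfield (R : realType) (m : nat) := 'rV[R]_m -> 'rV[R]_m.

Definition vfpair (R : realType) (m : nat) := (vfield R m * vfield R m)%type.

Section Coordinates.
Variable R : realType.

(* [ddx j] is the coordinate vector field of the j-th coordinate, with j
   counted from 0. *)
Definition ddx (m : nat) (j : 'I_m) : vfield R m := fun=> delta_mx 0 j.

Definition append_coord (m : nat) (x : 'rV[R]_m) (a : R) : 'rV[R]_m.+1 :=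
  \row_(j < m.+1) oapp (x 0) a (unlift ord_max j).

Definition last_coord (m : nat) (x : 'rV[R]_m.+1) : R := x 0 ord_max.

Definition drop_last (m : nat) (x : 'rV[R]_m.+1) : 'rV[R]_m := col' ord_max x.

Definition vlift (m : nat) (f : vfield R m) : vfield R m.+1 :=
  fun z => append_coord (f (drop_last z)) 0.

Definition row3 (a b c : R) : 'rV[R]_3 := \row_(j < 3) [:: a; b; c]`_j.

Definition lie (m : nat) (f : vfield R m.+1) (alpha : 'rV[R]_m.+1 -> R) :
    'rV[R]_m.+1 -> R :=
  fun z => 'D_(f z) alpha z.

Definition vf_push (m : nat) (phi psi : 'rV[R]_m.+1 -> 'rV[R]_m.+1)
    (f : vfield R m.+1) : vfield R m.+1 :=
  fun x => 'd phi (psi x) (f (psi x)).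

End Coordinates.

Section Smoothness.
Variables (R : realType) (m : nat) (V : normedModType R).

Fixpoint Ck_on (k : nat) (U : set 'rV[R]_m.+1) (f : 'rV[R]_m.+1 -> V) : Prop :=
  match k with
  | 0 => forall z, U z -> {for z, continuous f}
  | k'.+1 => (forall z, U z -> differentiable f z) /\
             (forall j, Ck_on k' U ('D_(delta_mx 0 j) f))
  end.

Definition smooth_on (U : set 'rV[R]_m.+1) (f : 'rV[R]_m.+1 -> V) : Prop :=
  forall k, Ck_on k U f.

Definition smooth_at (p : 'rV[R]_m.+1) (f : 'rV[R]_m.+1 -> V) : Prop :=
  exists2 U, open_nbhs p U & smooth_on U f.

End Smoothness.

(* [psi] is the inverse of the local diffeomorphism [phi] around [p]; only the
   germ of [phi] at [p] and the germ of [psi] at [phi p] matter. *)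
Definition local_inverse (R : realType) (m : nat)
    (phi psi : 'rV[R]_m.+1 -> 'rV[R]_m.+1) (p : 'rV[R]_m.+1) : Prop :=
  exists U V : set 'rV[R]_m.+1,
    [/\ open_nbhs p U, open V, phi @` U = V, (forall z, U z -> psi (phi z) = z)
      & smooth_on U phi /\ smooth_on V psi].

(* [z] is a trajectory, at the times in [J], of the control system
   z' = f_1(z) w_1 + f_2(z) w_2. *)
Definition trajectory (R : realType) (m : nat) (f : vfpair R m.+1)
    (J : set R) (z : R -> 'rV[R]_m.+1) (w1 w2 : R -> R) : Prop :=
  forall t, J t ->
    is_derive t (1 : R) z (w1 t *: f.1 (z t) + w2 t *: f.2 (z t)).

Section KumperaRuiz.
Variable R : realType.

Definition kappa3 : vfpair R 3 :=
  (ddx ord_max, fun x => last_coord x *: ddx 1 x + ddx 0 x).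

Definition regular_prolongation (c : R) (m : nat) (k : vfpair R m) :
    vfpair R m.+1 :=
  (ddx ord_max,
   fun x => (last_coord x + c) *: vlift k.1 x + vlift k.2 x).

Definition singular_prolongation (m : nat) (k : vfpair R m) : vfpair R m.+1 :=
  (ddx ord_max, fun x => vlift k.1 x + last_coord x *: vlift k.2 x).

Inductive KumperaRuiz : forall m : nat, vfpair R m -> Prop :=
| KR_base : KumperaRuiz kappa3
| KR_regular m (k : vfpair R m) (c : R) :
    KumperaRuiz k -> KumperaRuiz (regular_prolongation c k)
| KR_singular m (k : vfpair R m) :
    KumperaRuiz k -> KumperaRuiz (singular_prolongation k).

End KumperaRuiz.

(* A point of R^2 x (S^1)^(n+1) is given by its coordinates
   (xi_1, xi_2, theta_0, ..., theta_n) in R^(n+3), where the angles are real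
   representatives modulo 2 pi.  Two coordinate vectors describe the same point
   when [same_point] holds; everything below is invariant under this relation
   (lemmas [trailer_same_point], [nform_same_base] and [nform_same_point]), so
   it descends from R^(n+3) to the quotient R^2 x (S^1)^(n+1), of which R^(n+3)
   is a covering. *)
Definition same_point (R : realType) (m : nat) (z w : 'rV[R]_m) : Prop :=
  exists k : 'I_m -> int,
    w = z + \row_j (if (j < 2)%N then 0 else (k j)%:~R * (pi *+ 2)).

Section Trailer.
Variable R : realType.

(* theta_i - theta_(i-1), when the last two coordinates are angles. *)
Definition rel_angle (m : nat) (z : 'rV[R]_m.+2) : R :=
  last_coord z - last_coord (drop_last z).

Fixpoint trailer (n : nat) : vfpair R n.+3 :=
  match n with
  | 0 => (ddx ord_max,
          fun z => sin (last_coord z) *: ddx 1 z + cos (last_coord z) *: ddx 0 z)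
  | n'.+1 =>
      (ddx ord_max,
       fun z => sin (rel_angle z) *: vlift (trailer n').1 z
              + cos (rel_angle z) *: vlift (trailer n').2 z)
  end.

Definition pm_half_pi (a : R) : Prop :=
  exists k : int, a = pi / 2 + k%:~R * (pi *+ 2) \/
                  a = - (pi / 2) + k%:~R * (pi *+ 2).

Record nform_data (n : nat) := NForm {
  nf_phi : 'rV[R]_n.+3 -> 'rV[R]_n.+3;
  nf_mu : 'rV[R]_n.+3 -> R;
  nf_nu : 'rV[R]_n.+3 -> R;
  nf_eta : 'rV[R]_n.+3 -> R }.

Definition nform0 (p : 'rV[R]_3) : nform_data 0 :=
  if `[< ~ pm_half_pi (last_coord p) >] then
    NForm
      (fun z : 'rV[R]_3 => row3 (z 0 0) (z 0 1) (tan (last_coord z)))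
      (fun z : 'rV[R]_3 => cos (last_coord z))
      (fun z : 'rV[R]_3 => (cos (last_coord z))^-1 ^+ 2)
      (fun=> 0)
  else
    NForm
      (fun z : 'rV[R]_3 =>
         row3 (z 0 1) (z 0 0) (cos (last_coord z) / sin (last_coord z)))
      (fun z : 'rV[R]_3 => sin (last_coord z))
      (fun z : 'rV[R]_3 => - (sin (last_coord z))^-1 ^+ 2)
      (fun=> 0).

Definition nform_step (n : nat) (p : 'rV[R]_n.+4) (d : nform_data n) :
    nform_data n.+1 :=
  let s z := sin (rel_angle z) in
  let c z := cos (rel_angle z) in
  let mu z := nf_mu d (drop_last z) in
  let nu z := nf_nu d (drop_last z) in
  let eta z := nf_eta d (drop_last z) in
  let a z := c z * mu z in
  let b z := s z * nu z + c z * eta z in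
  let build (x mu' : 'rV[R]_n.+4 -> R) :=
    NForm (fun z => append_coord (nf_phi d (drop_last z)) (x z)) mu'
      (lie (trailer n.+1).1 x) (lie (trailer n.+1).2 x) in
  if `[< ~ pm_half_pi (rel_angle p) >] then build (fun z => b z / a z) a
  else build (fun z => a z / b z) b.

(* The maps (phi^n, mu_n, nu_n, eta_n) attached to the point p.  As x / 0 = 0,
   they are total; at each stage the denominator in the last coordinate of phi
   is mu_i, so they have their intended meaning where no mu_i vanishes. *)
Fixpoint nform (n : nat) : 'rV[R]_n.+3 -> nform_data n :=
  match n with
  | 0 => nform0
  | n'.+1 => fun p => nform_step p (nform (drop_last p))
  end.

End Trailer.


Section SamePoint.
Variable R : realType.

Lemma periodic_int (f : R -> R) (T a : R) (k : int) :
  periodic f T -> f (a + k%:~R * T) = f a.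
Proof.
move=> fT.
have pos (j : nat) b : f (b + j%:R * T) = f b.
  by rewrite mulr_natl periodicn.
case: k => j; first exact: pos.
by rewrite NegzE mulrNz mulNr -[in RHS](subrK (j.+1%:R * T) a) pos.
Qed.

Lemma sin_2pi_int (a : R) (k : int) : sin (a + k%:~R * (pi *+ 2)) = sin a.
Proof. by rewrite periodic_int //; exact: sinD2pi. Qed.

Lemma cos_2pi_int (a : R) (k : int) : cos (a + k%:~R * (pi *+ 2)) = cos a.
Proof. by rewrite periodic_int //; exact: cosD2pi. Qed.

Lemma same_point_drop m (z w : 'rV[R]_m.+1) :
  same_point z w -> same_point (drop_last z) (drop_last w).
Proof.
move=> [k ->]; exists (fun j => k (lift ord_max j)).
by apply/rowP => j; rewrite !mxE lift_max.
Qed.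

Lemma same_point_last m (z w : 'rV[R]_m.+3) :
  same_point z w ->
  exists k : int, last_coord w = last_coord z + k%:~R * (pi *+ 2).
Proof. by move=> [k ->]; exists (k ord_max); rewrite /last_coord !mxE. Qed.

Lemma same_point_rel_angle m (z w : 'rV[R]_m.+4) :
  same_point z w ->
  exists k : int, rel_angle w = rel_angle z + k%:~R * (pi *+ 2).
Proof.
move=> zw; have [k wk] := same_point_last zw.
have [l wl] := same_point_last (same_point_drop zw).
by exists (k - l); rewrite /rel_angle wk wl; ring.
Qed.

Lemma pm_half_pi_period (a : R) (k : int) :
  pm_half_pi (a + k%:~R * (pi *+ 2)) = pm_half_pi a.
Proof.
apply/propext; split=> -[l [] H].
- by exists (l - k); left; rewrite -[LHS](addrK (k%:~R * (pi *+ 2))) H; ring.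
- by exists (l - k); right; rewrite -[LHS](addrK (k%:~R * (pi *+ 2))) H; ring.
- by exists (l + k); left; rewrite H; ring.
- by exists (l + k); right; rewrite H; ring.
Qed.

Lemma trailer_same_point n (z w : 'rV[R]_n.+3) :
  same_point z w ->
  (trailer R n).1 z = (trailer R n).1 w /\ (trailer R n).2 z = (trailer R n).2 w.
Proof.
elim: n z w => [|n IH] z w zw /=.
  have [k ->] := same_point_last zw.
  by rewrite sin_2pi_int cos_2pi_int.
have [k ->] := same_point_rel_angle zw.
have [e1 e2] := IH _ _ (same_point_drop zw).
by rewrite sin_2pi_int cos_2pi_int /vlift e1 e2.
Qed.

Lemma nform_same_base n (p q : 'rV[R]_n.+3) :
  same_point p q -> nform p = nform q.
Proof.
elim: n p q => [|n IH] p q pq /=.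
  have [k e] := same_point_last pq.
  by rewrite /nform0 e pm_half_pi_period.
have [k e] := same_point_rel_angle pq.
by rewrite (IH _ _ (same_point_drop pq)) /nform_step e pm_half_pi_period.
Qed.

Lemma lie_same_point m (f : vfield R m.+1) (alpha : 'rV[R]_m.+1 -> R) z w :
  (forall x y, same_point x y -> f x = f y) ->
  (forall x y, same_point x y -> alpha x = alpha y) ->
  same_point z w -> lie f alpha z = lie f alpha w.
Proof.
move=> ff aa zw; rewrite /lie -(ff _ _ zw).
rewrite /derive; congr (lim (_ @ 0^')); apply/funext => h /=.
rewrite -(aa _ _ zw); congr (_ *: (_ - _)).
by apply: aa; case: zw => k ->; exists k; rewrite addrA.
Qed.

Lemma nform_same_point n (p z w : 'rV[R]_n.+3) :
  same_point z w ->
  [/\ nf_phi (nform p) z = nf_phi (nform p) w,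
      nf_mu (nform p) z = nf_mu (nform p) w,
      nf_nu (nform p) z = nf_nu (nform p) w
    & nf_eta (nform p) z = nf_eta (nform p) w].
Proof.
elim: n p z w => [|n IH] p z w zw.
  have [k e] := same_point_last zw.
  have e0 : w 0 0 = z 0 0 by case: zw => l ->; rewrite !mxE addr0.
  have e1 : w 0 1 = z 0 1 by case: zw => l ->; rewrite !mxE addr0.
  rewrite /= /nform0; case: asboolP => _ /=;
    by rewrite /tan e e0 e1 ?sin_2pi_int cos_2pi_int.
set d := nform (drop_last p).
pose c (z : 'rV[R]_n.+4) := cos (rel_angle z).
pose s (z : 'rV[R]_n.+4) := sin (rel_angle z).
have cE x y : same_point x y -> c x = c y.
  move=> /same_point_rel_angle[k e].
  by rewrite /c e cos_2pi_int.
have sE x y : same_point x y -> s x = s y.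
  move=> /same_point_rel_angle[k e].
  by rewrite /s e sin_2pi_int.
pose a z := c z * nf_mu d (drop_last z).
pose b z := s z * nf_nu d (drop_last z) + c z * nf_eta d (drop_last z).
have aE x y : same_point x y -> a x = a y.
  move=> xy; have [_ e _ _] := IH (drop_last p) _ _ (same_point_drop xy).
  by rewrite /a (cE _ _ xy) e.
have bE x y : same_point x y -> b x = b y.
  move=> xy; have [_ _ e e'] := IH (drop_last p) _ _ (same_point_drop xy).
  by rewrite /b (cE _ _ xy) (sE _ _ xy) e e'.
have [ephi _ _ _] := IH (drop_last p) _ _ (same_point_drop zw).
rewrite /= /nform_step; case: asboolP => _ /=; split.
- by rewrite ephi -/(a z) -/(a w) -/(b z) -/(b w) (aE _ _ zw) (bE _ _ zw).
- exact: aE.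
- by apply: lie_same_point zw => x y xy //;
    rewrite -/(a x) -/(a y) -/(b x) -/(b y) (aE _ _ xy) (bE _ _ xy).
- apply: lie_same_point zw => x y xy.
    exact: (proj2 (trailer_same_point (n := n.+1) xy)).
  by rewrite -/(a x) -/(a y) -/(b x) -/(b y) (aE _ _ xy) (bE _ _ xy).
- by rewrite ephi -/(a z) -/(a w) -/(b z) -/(b w) (aE _ _ zw) (bE _ _ zw).
- exact: bE.
- by apply: lie_same_point zw => x y xy //;
    rewrite -/(a x) -/(a y) -/(b x) -/(b y) (aE _ _ xy) (bE _ _ xy).
- apply: lie_same_point zw => x y xy.
    exact: (proj2 (trailer_same_point (n := n.+1) xy)).
  by rewrite -/(a x) -/(a y) -/(b x) -/(b y) (aE _ _ xy) (bE _ _ xy).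
Qed.

End SamePoint.

(* Main.v *)
(* In suitable coordinates the last component of phi^n is the tangent or the
   cotangent of theta_n - theta_(n-1), transformed by a homography whose
   coefficients mu, nu, eta depend only on the previous coordinates.  Hence
   phi^n is triangular and its inverse is explicit, the last coordinate being
   recovered by an arctangent, so that the inverse function theorem is not
   needed.  If (a, b) denotes (c mu, s nu + c eta), the derivative of phi^(n-1)
   maps s tau_1 + c tau_2 to b kappa_1 + a kappa_2, which is
   a ((b / a) kappa_1 + kappa_2) = b (kappa_1 + (a / b) kappa_2): the two
   prolongations, with x_(n+3) = b / a and x_(n+3) = a / b.  All the constants
   of the regular prolongations are 0 because phi^n is not centered at p.  The
   initial system is itself the step from the frame (d/dxi_2, d/dxi_1) of the
   plane, in which mu = nu = 1 and eta = 0. *)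

Require Import Defs.
From mathcomp Require Import all_boot all_order all_algebra.
From mathcomp Require Import all_classical all_reals all_analysis.
From mathcomp Require Import ring lra.

Set Implicit Arguments.
Unset Strict Implicit.
Unset Printing Implicit Defensive.

Import Order.TTheory GRing.Theory Num.Theory.
Import numFieldNormedType.Exports.

Local Open Scope classical_set_scope.
Local Open Scope ring_scope.

(** * Smooth functions on open sets of R^m *)

(** The first-order expansion of [f] at [x] is also one of [g], the two agreeing at [x] and near it;
    uniqueness of the differential does the rest. *)
Lemma near_eq_diff (R : realType) (V W : normedModType R) (f g : V -> W) x :
  {near x, f =1 g} -> differentiable f x ->
  differentiable g x /\ 'd g x = 'd f x :> (V -> W).
Proof.
move=> fg df.
have E : g \o shift x = cst (g x) + 'd f x +o_ 0 id.
  have /eqaddoP H := diff_locally df.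
  apply/eqaddoP => e e0.
  have gx := nbhs_singleton fg.
  near=> h.
  have fh : f (h + x) = g (h + x).
    by near: h; move: fg; rewrite (near_shift 0 x) /= subr0.
  have : `|(f \o shift x - (cst (f x) + 'd f x)) h| <= e * `|h|.
    by near: h; exact: H.
  by rewrite !fctE fh gx.
have D : 'd g x = 'd f x :> (V -> W).
  by apply: diff_unique => //; exact: diff_continuous.
split=> //; apply/diff_locallyP; rewrite D; split => //; exact: diff_continuous.
Unshelve. all: by end_near. Qed.

Section ContinuouslyDifferentiable.
Context {R : realType} {m : nat}.
Implicit Types (U : set 'rV[R]_m.+1) (k : nat).

(** As [U] is open, functions equal on [U] have equal partial derivatives there, so the induction
    closes. Below, this is what replaces a derivative by a closed formula valid only on [U]. *)
Lemma eq_Ck_on (V : normedModType R) k U (f g : 'rV[R]_m.+1 -> V) :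
  open U -> {in U, f =1 g} -> Ck_on k U f -> Ck_on k U g.
Proof.
move=> oU.
have near_fg (f' g' : 'rV[R]_m.+1 -> V) z :
    {in U, f' =1 g'} -> U z -> {near z, f' =1 g'}.
  by move=> fg Uz; near=> y; apply: fg; rewrite inE; near: y;
    exact: open_nbhs_nbhs.
elim: k f g => [|k IH] f g fg /=.
  move=> fc z Uz; have fz : f @ z --> f z := fc z Uz.
  suff : g @ z --> g z by [].
  have fgz : {near z, f =1 g} := near_fg _ _ _ fg Uz.
  rewrite -(fg z) ?inE//; exact: cvg_trans (near_eq_cvg fgz) fz.
move=> [df Cf]; split=> [z Uz|j].
  by have [] := near_eq_diff (near_fg _ _ _ fg Uz) (df _ Uz).
apply: IH (Cf j) => z; rewrite inE => Uz.
by apply: near_eq_derive; exact: near_fg.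
Unshelve. all: by end_near. Qed.

Lemma Ck_onW (V : normedModType R) k U (f : 'rV[R]_m.+1 -> V) :
  Ck_on k.+1 U f -> Ck_on k U f.
Proof.
elim: k f => [|k IH] f [df Cf] /=.
  by move=> z Uz; exact/differentiable_continuous/df.
by split=> // j; apply: IH.
Qed.

Lemma Ck_on_differentiable (V : normedModType R) k U (f : 'rV[R]_m.+1 -> V) z :
  Ck_on k.+1 U f -> U z -> differentiable f z.
Proof. by move=> [df _]; exact: df. Qed.

Lemma Ck_on_sub (V : normedModType R) k U U' (f : 'rV[R]_m.+1 -> V) :
  U' `<=` U -> Ck_on k U f -> Ck_on k U' f.
Proof.
move=> UU; elim: k f => [|k IH] f /=; first by move=> fc z /UU; exact: fc.
by move=> [df Cf]; split=> [z /UU|j]; [exact: df|exact: IH].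
Qed.

Lemma Ck_on_cst (V : normedModType R) k U (a : V) :
  Ck_on k U (fun=> a : V).
Proof.
elim: k a => [|k IH] a /=; first by move=> z _; exact: cst_continuous.
split=> [z _|j]; first exact: differentiable_cst.
rewrite (_ : 'D__ _ = fun=> 0); first exact: IH.
by apply/funext => z; rewrite derive_cst.
Qed.

Lemma Ck_onD (V : normedModType R) k U (f g : 'rV[R]_m.+1 -> V) : open U ->
  Ck_on k U f -> Ck_on k U g -> Ck_on k U (fun z => f z + g z).
Proof.
move=> oU; elim: k f g => [|k IH] f g /=.
  by move=> fc gc z Uz; apply: (@continuousD _ _ _ f g); [exact: fc|exact: gc].
move=> [df Cf] [dg Cg]; split=> [z Uz|j].
  by apply: differentiableD; [exact: df|exact: dg].
apply: eq_Ck_on (IH _ _ (Cf j) (Cg j)) => // z; rewrite inE => Uz.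
by rewrite (@deriveD _ _ _ f g) //;
  [exact/diff_derivable/df|exact/diff_derivable/dg].
Qed.

Lemma Ck_onM k U (f g : 'rV[R]_m.+1 -> R) : open U ->
  Ck_on k U f -> Ck_on k U g -> Ck_on k U (fun z => f z * g z).
Proof.
move=> oU; elim: k f g => [|k IH] f g.
  by move=> /= fc gc z Uz; apply: (@continuousM _ _ f g); [exact: fc|exact: gc].
move=> Cf Cg; have [df pf] := Cf; have [dg pg] := Cg; split=> [z Uz|j].
  by apply: differentiableM; [exact: df|exact: dg].
(* In each Leibniz term the undifferentiated factor is weakened from order [k.+1] to order [k], so
   that the induction hypothesis applies to both. *)
apply: eq_Ck_on (Ck_onD oU (IH _ _ (Ck_onW Cf) (pg j))
                           (IH _ _ (Ck_onW Cg) (pf j))) => // z.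
rewrite inE => Uz.
by rewrite (@deriveM _ _ f g) //;
  [exact/diff_derivable/df|exact/diff_derivable/dg].
Qed.

End ContinuouslyDifferentiable.

Lemma diff_comp1 (R : realType) (V : normedModType R) (f : V -> R) (g : R -> R)
    (dg : R) z :
  differentiable f z -> is_derive (f z) (1 : R) g dg ->
  differentiable (g \o f) z /\ forall v, 'D_v (g \o f) z = dg * 'D_v f z.
Proof.
move=> df [dg1 dgE].
have dg' : differentiable g (f z) by exact/derivable1_diffP.
have dgf : differentiable (g \o f) z by exact: differentiable_comp.
have E : 'd g (f z) 1 = dg by rewrite -deriveE.
split=> // v; rewrite !deriveE // diff_comp //=.
(* A linear map on the line is multiplication by its value at 1, here [dg]. *)
transitivity ('d g (f z) ('d f z v *: 1)); first by rewrite [_ *: _]mulr1.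
by rewrite linearZ /= E mulrC.
Qed.

Section Calculus.
Context {R : realType} {m : nat}.
Implicit Types (U : set 'rV[R]_m.+1) (k : nat) (f g : 'rV[R]_m.+1 -> R).

Lemma Ck_on_coord k U (i : 'I_m.+1) : Ck_on k U (fun z : 'rV[R]_m.+1 => z 0 i).
Proof.
have dE v : 'D_v (fun z : 'rV[R]_m.+1 => z 0 i) = (fun=> v 0 i).
  apply/funext => z.
  (* The coordinate is an entry of the identity map, whose derivative along [v] is [v]. *)
  have /derive_mx/(congr1 (fun u : 'rV_m.+1 => u 0 i)) := @derivable_id _ _ z v.
  by rewrite derive_id mxE.
case: k => [|k] /=.
  by move=> z _; exact/differentiable_continuous/differentiable_coord.
split=> [z _|j]; first exact: differentiable_coord.
rewrite dE; exact: Ck_on_cst.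
Qed.

Lemma Ck_onN k U f : open U -> Ck_on k U f -> Ck_on k U (fun z => - f z).
Proof.
move=> oU Cf; apply: eq_Ck_on (Ck_onM oU (Ck_on_cst k U (-1 : R)) Cf) => //.
by move=> z _; rewrite mulN1r.
Qed.

Lemma Ck_onB k U f g : open U -> Ck_on k U f -> Ck_on k U g ->
  Ck_on k U (fun z => f z - g z).
Proof. by move=> oU Cf Cg; apply: (Ck_onD oU Cf); exact: Ck_onN. Qed.

Lemma Ck_on_sum (V : normedModType R) k U (I : Type) (r : seq I)
    (F : I -> 'rV[R]_m.+1 -> V) :
  open U -> (forall i, Ck_on k U (F i)) ->
  Ck_on k U (fun z => \sum_(i <- r) F i z).
Proof.
move=> oU CF; elim: r => [|i r IH].
  by apply: eq_Ck_on (Ck_on_cst k U (0 : V)) => // z _; rewrite big_nil.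
by apply: eq_Ck_on (Ck_onD oU (CF i) IH) => // z _; rewrite big_cons.
Qed.

(** By the chain rule each partial derivative is [dg (f z)] times a partial derivative of [f]. One
    order of smoothness is thus gained from that of [dg] along [f], which drives the elementary
    functions below. *)
Lemma Ck_onS_comp1 k U f (g dg : R -> R) : open U -> Ck_on k.+1 U f ->
  (forall z, U z -> is_derive (f z) (1 : R) g (dg (f z))) ->
  Ck_on k U (fun z => dg (f z)) -> Ck_on k.+1 U (fun z => g (f z)).
Proof.
move=> oU Cf gf Cdg; have [df pf] := Cf; split=> [z Uz|j].
  by have [] := diff_comp1 (df z Uz) (gf z Uz).
apply: eq_Ck_on (Ck_onM oU Cdg (pf j)) => // z; rewrite inE => Uz.
by have [_ <-] := diff_comp1 (df z Uz) (gf z Uz).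
Qed.

Lemma Ck_on0_comp1 U f (g : R -> R) :
  (forall z, U z -> {for f z, continuous g}) ->
  Ck_on 0 U f -> Ck_on 0 U (fun z => g (f z)).
Proof.
by move=> gc fc z Uz; apply: (@continuous_comp _ _ _ f g);
  [exact: fc|exact: gc].
Qed.

(** Sine and cosine are treated together because each is, up to sign, the derivative of the
    other. *)
Lemma Ck_on_sin_cos k U f : open U -> Ck_on k U f ->
  Ck_on k U (fun z => sin (f z)) /\ Ck_on k U (fun z => cos (f z)).
Proof.
move=> oU; elim: k => [|k IH] Cf.
  by split; apply: Ck_on0_comp1 Cf => z _;
    [exact: continuous_sin|exact: continuous_cos].
have [Cs Cc] := IH (Ck_onW Cf); split.
  exact: (Ck_onS_comp1 oU Cf (fun z _ => is_derive_sin (f z)) Cc).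
exact: (Ck_onS_comp1 (dg := fun x => - sin x) oU Cf
  (fun z _ => is_derive_cos (f z)) (Ck_onN oU Cs)).
Qed.

(** The derivative of the inverse is a polynomial in the inverse itself, so the induction feeds on
    its own hypothesis. *)
Lemma Ck_onV k U f : open U -> (forall z, U z -> f z != 0) ->
  Ck_on k U f -> Ck_on k U (fun z => (f z)^-1).
Proof.
move=> oU f0; elim: k => [|k IH] Cf.
  by move=> z Uz; apply: continuousV; [exact: f0|exact: Cf].
have CV := IH (Ck_onW Cf).
apply: (Ck_onS_comp1 (g := GRing.inv) (dg := fun x => - (x^-1 * x^-1)) oU Cf).
  move=> z Uz.
  apply: is_derive_eq (is_deriveV (f0 z Uz) (is_derive_id (f z) (1 : R))) _.
  by rewrite /GRing.scale /= mulr1 -exprVn expr2.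
exact/Ck_onN/Ck_onM.
Qed.

Lemma Ck_on_div k U f g : open U -> (forall z, U z -> g z != 0) ->
  Ck_on k U f -> Ck_on k U g -> Ck_on k U (fun z => f z / g z).
Proof. by move=> oU g0 Cf Cg; apply: (Ck_onM oU Cf); exact: Ck_onV. Qed.

(** The derivative of the arctangent is rational with a positive denominator; the previous results
    suffice, without induction. *)
Lemma Ck_on_atan k U f : open U -> Ck_on k U f ->
  Ck_on k U (fun z => atan (f z)).
Proof.
move=> oU; case: k => [|k] Cf.
  by apply: Ck_on0_comp1 Cf => z _; exact: continuous_atan.
apply: (Ck_onS_comp1 (dg := fun x => (1 + x ^+ 2)^-1) oU Cf
  (fun z _ => is_derive1_atan (f z))).
apply: Ck_onV => // [z _|]; first by apply: lt0r_neq0;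
  rewrite ltr_pwDl ?sqr_ge0.
apply: Ck_onD => //; first exact: Ck_on_cst.
by apply: Ck_onM => //; exact: Ck_onW.
Qed.

Lemma differentiable_rowP n (h : 'rV[R]_m.+1 -> 'rV[R]_n) z :
  differentiable h z <-> forall i, differentiable (fun z => h z 0 i) z.
Proof.
split=> [dh i|dh].
  exact: (@differentiable_comp _ _ _ _ h (fun u => u 0 i) z dh
    (differentiable_coord _ _ _)).
rewrite (_ : h = \sum_(i < n) (fun z => h z 0 i *: delta_mx 0 i)).
  by apply: differentiable_sum => i; exact: differentiableZl.
by apply/funext => u; rewrite fct_sumE; exact: row_sum_delta.
Qed.

Lemma derive_row n (h : 'rV[R]_m.+1 -> 'rV[R]_n) z v i :
  differentiable h z -> 'D_v h z 0 i = 'D_v (fun z => h z 0 i) z.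
Proof. by move=> dh; rewrite derive_mx ?mxE //; exact: diff_derivable. Qed.

Lemma Ck_on_rowP k U n (h : 'rV[R]_m.+1 -> 'rV[R]_n) : open U ->
  Ck_on k U h <-> forall i, Ck_on k U (fun z => h z 0 i).
Proof.
move=> oU; elim: k h => [|k IH] h.
  split=> [hc i z Uz|hc z Uz].
    apply: (@continuous_comp _ _ _ h (fun u : 'rV[R]_n => u 0 i));
      first exact: hc.
    exact: coord_continuous.
  rewrite (_ : h = (fun z => \sum_(i < n) h z 0 i *: delta_mx 0 i)); last first.
    by apply/funext => u; exact: row_sum_delta.
  have : Ck_on 0 U (fun z => \sum_(i < n) h z 0 i *: (delta_mx 0 i : 'rV[R]_n)).
    apply: Ck_on_sum => // i w Uw.
    by apply: continuousZr_tmp; exact: hc.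
  exact.
split=> [[dh ph] i|Ch].
  split=> [z Uz|j]; first by have /differentiable_rowP := dh z Uz; exact.
  apply: eq_Ck_on (proj1 (IH _) (ph j) i) => // z; rewrite inE => Uz.
  by rewrite derive_row //; exact: dh.
have dh z : U z -> differentiable h z.
  by move=> Uz; apply/differentiable_rowP => i; have [dhi _] := Ch i;
    exact: dhi.
split=> // j; apply/IH => i; have [_ phi] := Ch i.
apply: eq_Ck_on (phi j) => // z; rewrite inE => Uz.
by rewrite derive_row //; exact: dh.
Qed.

End Calculus.

Lemma derive_sum_partial (R : realType) (V : normedModType R) m
    (f : 'rV[R]_m.+1 -> V) z v :
  differentiable f z -> 'D_v f z =
    \sum_(i < m.+1) v 0 i *: 'D_(delta_mx 0 i) f z.
Proof.
move=> df; rewrite deriveE // {1}(row_sum_delta v) linear_sum /=.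
by apply: eq_bigr => i _; rewrite linearZ /= deriveE.
Qed.

(** A partial derivative of the composite is the sum of the partial derivatives of [f] taken at
    [h z], weighted by those of the components of [h]. The former are composites of lower order, to
    which the induction applies. *)
Lemma Ck_on_comp (R : realType) m n k (U : set 'rV[R]_m.+1)
    (V : set 'rV[R]_n.+1) (f : 'rV[R]_n.+1 -> R)
    (h : 'rV[R]_m.+1 -> 'rV[R]_n.+1) :
  open U -> (forall z, U z -> V (h z)) -> Ck_on k V f -> Ck_on k U h ->
  Ck_on k U (fun z => f (h z)).
Proof.
move=> oU UV; elim: k f => [|k IH] f Cf Ch.
  move=> z Uz; apply: (@continuous_comp _ _ _ h f); first exact: Ch.
  exact/Cf/UV.
have [df pf] := Cf; have [dh ph] := Ch; split=> [z Uz|j].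
  by apply: (@differentiable_comp _ _ _ _ h f); [exact: dh|exact/df/UV].
have Chi := proj1 (Ck_on_rowP k.+1 h oU) Ch.
have : Ck_on k U (fun z => \sum_(i < n.+1)
    'D_(delta_mx 0 j) (fun z => h z 0 i) z * 'D_(delta_mx 0 i) f (h z)).
  apply: Ck_on_sum => // i; apply: Ck_onM => //; first by have [_] := Chi i;
    exact.
  exact: IH (pf i) (Ck_onW Ch).
apply: eq_Ck_on => // z; rewrite inE => Uz.
have dhz := dh z Uz; have dfz := df _ (UV z Uz).
transitivity ('D_('D_(delta_mx 0 j) h z) f (h z)).
  by rewrite derive_sum_partial //; apply: eq_bigr => i _; rewrite derive_row.
have dfh : differentiable (f \o h) z by exact: differentiable_comp.
rewrite -[RHS]/('D_(delta_mx 0 j) (f \o h) z).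
rewrite (deriveE _ dfh) !deriveE //.
by rewrite (diff_comp dhz dfz).
Qed.

(** * Appending a coordinate *)

Section AppendCoord.
Variables (R : realType) (m : nat).
Implicit Types (x y : 'rV[R]_m) (z w : 'rV[R]_m.+1) (a b : R).

Lemma append_coordK x a : drop_last (append_coord x a) = x.
Proof. by apply/rowP => j; rewrite !mxE liftK. Qed.

Lemma last_append_coord x a : last_coord (append_coord x a) = a.
Proof. by rewrite /last_coord !mxE unlift_none. Qed.

Lemma append_drop_last z : append_coord (drop_last z) (last_coord z) = z.
Proof.
apply/rowP => j; rewrite !mxE.
by case: unliftP => [i ->|->] //=; rewrite mxE.
Qed.

Lemma eq_drop_last z w :
  drop_last z = drop_last w -> last_coord z = last_coord w -> z = w.
Proof.
by move=> e1 e2; rewrite -(append_drop_last z) e1 e2 append_drop_last.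
Qed.

Lemma drop_lastD z w : drop_last (z + w) = drop_last z + drop_last w.
Proof. by apply/rowP => j; rewrite !mxE. Qed.

Lemma drop_lastZ a z : drop_last (a *: z) = a *: drop_last z.
Proof. by apply/rowP => j; rewrite !mxE. Qed.

Lemma last_coordD z w : last_coord (z + w) = last_coord z + last_coord w.
Proof. by rewrite /last_coord mxE. Qed.

Lemma last_coordZ a z : last_coord (a *: z) = a * last_coord z.
Proof. by rewrite /last_coord mxE. Qed.

Lemma drop_last_ddx_max z : drop_last (ddx (R := R) ord_max z) = 0.
Proof. by apply/rowP => j; rewrite !mxE eq_sym (negPf (neq_lift _ _)). Qed.

Lemma last_coord_ddx_max z : last_coord (ddx (R := R) ord_max z) = 1.
Proof. by rewrite /last_coord mxE !eqxx. Qed.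

End AppendCoord.

Definition append_coordE := (append_coordK, last_append_coord, drop_lastD,
  drop_lastZ, last_coordD, last_coordZ, drop_last_ddx_max, last_coord_ddx_max).

Section AppendCalculus.
Variables (R : realType) (m : nat).
Implicit Types k : nat.

Lemma Ck_on_drop_last k (U : set 'rV[R]_m.+2) : open U ->
  Ck_on k U (@drop_last R m.+1).
Proof.
move=> oU; apply/(Ck_on_rowP _ _ oU) => i.
by apply: eq_Ck_on (Ck_on_coord k U (lift ord_max i)) => // z _; rewrite mxE.
Qed.

Lemma Ck_on_last_coord n k (U : set 'rV[R]_n.+1) : Ck_on k U (@last_coord R n).
Proof. exact: Ck_on_coord. Qed.

Lemma differentiable_drop_last (z : 'rV[R]_m.+2) :
  differentiable (@drop_last R m.+1) z.
Proof. exact: Ck_on_differentiable (Ck_on_drop_last 1 openT) _. Qed.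

Lemma derive_coord n (z v : 'rV[R]_n.+1) i :
  'D_v (fun z : 'rV[R]_n.+1 => z 0 i) z = v 0 i.
Proof. by rewrite -derive_row ?derive_id. Qed.

Lemma derive_last_coord n (z v : 'rV[R]_n.+1) :
  'D_v (@last_coord R n) z = last_coord v.
Proof. exact: derive_coord. Qed.

Lemma derive_drop_last (z v : 'rV[R]_m.+2) :
  'D_v (@drop_last R m.+1) z = drop_last v.
Proof.
apply/rowP => i; rewrite derive_row; last exact: differentiable_drop_last.
rewrite (_ : (fun w => _) = fun w : 'rV[R]_m.+2 => w 0 (lift ord_max i));
  last first.
  by apply/funext => w; rewrite mxE.
by rewrite derive_coord mxE.
Qed.

Lemma differentiable_comp_drop (V : normedModType R) (f : 'rV[R]_m.+1 -> V)
    (z : 'rV[R]_m.+2) :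
  differentiable f (drop_last z) -> differentiable (fun z => f (drop_last z)) z.
Proof.
by move=> df; apply: (@differentiable_comp _ _ _ _ (@drop_last R m.+1) f) => //;
  exact: differentiable_drop_last.
Qed.

Lemma derive_comp_drop (V : normedModType R) (f : 'rV[R]_m.+1 -> V)
    (z v : 'rV[R]_m.+2) :
  differentiable f (drop_last z) ->
  'D_v (fun z => f (drop_last z)) z = 'D_(drop_last v) f (drop_last z).
Proof.
move=> df; have dd := differentiable_drop_last z.
rewrite deriveE; last exact: differentiable_comp_drop.
rewrite -[X in 'd X _]/(f \o @drop_last R m.+1) (diff_comp dd df) /=.
by rewrite [RHS]deriveE // -(deriveE v dd) derive_drop_last.
Qed.

Lemma Ck_on_comp_drop k (U : set 'rV[R]_m.+2) (V : set 'rV[R]_m.+1)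
    (f : 'rV[R]_m.+1 -> R) :
  open U -> (forall z, U z -> V (drop_last z)) -> Ck_on k V f ->
  Ck_on k U (fun z => f (drop_last z)).
Proof.
by move=> oU UV Cf; apply: (Ck_on_comp oU UV Cf); exact: Ck_on_drop_last.
Qed.

Lemma Ck_on_append n k (U : set 'rV[R]_n.+1)
    (g : 'rV[R]_n.+1 -> 'rV[R]_m.+1) (y : 'rV[R]_n.+1 -> R) :
  open U -> Ck_on k U g -> Ck_on k U y ->
  Ck_on k U (fun z => append_coord (g z) (y z)).
Proof.
move=> oU /(Ck_on_rowP _ _ oU) Cg Cy; apply/(Ck_on_rowP _ _ oU) => i.
case: (unliftP ord_max i) => [j ->|->].
  by apply: eq_Ck_on (Cg j) => // z _; rewrite mxE liftK.
by apply: eq_Ck_on Cy => // z _; rewrite mxE unlift_none.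
Qed.

Lemma derive_append n (g : 'rV[R]_n.+1 -> 'rV[R]_m.+1) (y : 'rV[R]_n.+1 -> R)
    (z v : 'rV[R]_n.+1) :
  differentiable g z -> differentiable y z ->
  differentiable (fun z => append_coord (g z) (y z)) z /\
  'D_v (fun z => append_coord (g z) (y z)) z =
    append_coord ('D_v g z) ('D_v y z).
Proof.
move=> dg dy.
have gE j : (fun z => append_coord (g z) (y z) 0 (lift ord_max j)) =
    (fun z => g z 0 j).
  by apply/funext => w; rewrite mxE liftK.
have yE : (fun z => append_coord (g z) (y z) 0 ord_max) = y.
  by apply/funext => w; rewrite mxE unlift_none.
have da : differentiable (fun z => append_coord (g z) (y z)) z.
  apply/differentiable_rowP => i; case: (unliftP ord_max i) => [j ->|->].
    by rewrite gE; move/differentiable_rowP: dg; exact.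
  by rewrite yE.
split=> //; apply/rowP => i; rewrite derive_row // mxE.
by case: (unliftP ord_max i) => [j ->|->] /=; rewrite ?gE ?yE ?derive_row.
Qed.

(** In coordinates the Lie derivative is the sum of the components of [f] times the partial
    derivatives of [a]; it costs one order of differentiability of [a]. *)
Lemma Ck_on_lie n k (U : set 'rV[R]_n.+1) (f : vfield R n.+1)
    (a : 'rV[R]_n.+1 -> R) :
  open U -> Ck_on k U f -> Ck_on k.+1 U a -> Ck_on k U (lie f a).
Proof.
move=> oU Cf Ca; have [da pa] := Ca.
have Cfi := proj1 (Ck_on_rowP k f oU) Cf.
have : Ck_on k U (fun z => \sum_(i < n.+1) f z 0 i * 'D_(delta_mx 0 i) a z).
  by apply: Ck_on_sum => // i; exact: Ck_onM (Cfi i) (pa i).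
apply: eq_Ck_on => // z; rewrite inE => Uz.
by rewrite /lie derive_sum_partial //; exact: da.
Qed.

End AppendCalculus.

Lemma derive_div (R : realType) (V : normedModType R) (f g : V -> R) (z v : V) :
  derivable f z v -> derivable g z v -> g z != 0 ->
  'D_v (fun z => f z / g z) z =
    ('D_v f z * g z - f z * 'D_v g z) / g z ^+ 2.
Proof.
move=> df dg g0; have dV := derivableV g0 dg.
have -> : 'D_v (fun z => f z / g z) z = 'D_v (f * (fun z => (g z)^-1)) z by [].
by rewrite (deriveM df dV) (deriveV g0 dg) /GRing.scale /=; field.
Qed.

(** * Charts transforming a pair of fields up to feedback *)

(** The invariant of the induction over trailers. The push-forward identities are stated at the
    source point, and the inverse is carried along explicitly. Smoothness of [tau] is included
    because the next [eta] is a Lie derivative along a field built from it. *)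
Record feedback_chart (R : realType) (m : nat) (tau kappa : vfpair R m.+1)
    (phi psi : 'rV[R]_m.+1 -> 'rV[R]_m.+1) (mu nu eta : 'rV[R]_m.+1 -> R)
    (U V : set 'rV[R]_m.+1) : Prop := FeedbackChart {
  fc_openU : open U;
  fc_openV : open V;
  fc_phi : forall z, U z -> V (phi z);
  fc_psi : forall x, V x -> U (psi x);
  fc_phiK : forall z, U z -> psi (phi z) = z;
  fc_psiK : forall x, V x -> phi (psi x) = x;
  fc_smooth_phi : smooth_on U phi;
  fc_smooth_psi : smooth_on V psi;
  fc_smooth_mu : smooth_on U mu;
  fc_smooth_nu : smooth_on U nu;
  fc_smooth_eta : smooth_on U eta;
  fc_smooth_tau1 : smooth_on U tau.1;
  fc_smooth_tau2 : smooth_on U tau.2;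
  fc_mu_neq0 : forall z, U z -> mu z != 0;
  fc_nu_neq0 : forall z, U z -> nu z != 0;
  fc_push1 : forall z, U z -> 'd phi z (tau.1 z) = nu z *: kappa.1 (phi z);
  fc_push2 : forall z, U z ->
    'd phi z (tau.2 z) = eta z *: kappa.1 (phi z) + mu z *: kappa.2 (phi z) }.

Lemma smooth_differentiable (R : realType) m (V : normedModType R) U
    (f : 'rV[R]_m.+1 -> V) z : smooth_on U f -> U z -> differentiable f z.
Proof. by move=> Cf; exact: Ck_on_differentiable (Cf 1). Qed.

(** Continuity of [f] is known on [U] only, so the preimage is taken inside [U]. It serves to cut
    out the chart domains by strict conditions. *)
Lemma open_smooth_preimage (R : realType) m (V : normedModType R)
    (U : set 'rV[R]_m.+1) (f : 'rV[R]_m.+1 -> V) (A : set V) :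
  open U -> smooth_on U f -> open A -> open [set z | U z /\ A (f z)].
Proof.
move=> oU Cf oA; rewrite openE => z [Uz Afz]; near=> w; split.
  by near: w; exact: open_nbhs_nbhs.
near: w; have fz : f @ z --> f z := Cf 0 z Uz.
by apply: fz; exact: open_nbhs_nbhs.
Unshelve. all: by end_near. Qed.

Section Prolongation.
Variables (R : realType) (m : nat) (tau kappa : vfpair R m.+1).
Variables (phi psi : 'rV[R]_m.+1 -> 'rV[R]_m.+1) (mu nu eta : 'rV[R]_m.+1 -> R).
Variables (U V : set 'rV[R]_m.+1).
Hypothesis C : feedback_chart tau kappa phi psi mu nu eta U V.

(** The differential of [phi'] is block triangular: that of [phi] on the dropped vector, then the
    derivative of [x]. On a field of [tau'] the last entry is the Lie derivative of [x], the wanted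
    coefficient of [ddx ord_max]. Hence only the first components of the image of [tau2] remain to
    be compared with [kappa2]. *)
Lemma append_feedback_chart (tau2 : vfield R m.+2) (kappa2 : vfield R m.+2)
    (x y mu' : 'rV[R]_m.+2 -> R) (U' V' : set 'rV[R]_m.+2) :
  let tau' := (ddx ord_max, tau2) in
  let phi' z := append_coord (phi (drop_last z)) (x z) in
  let psi' w := append_coord (psi (drop_last w)) (y w) in
  open U' -> open V' ->
  (forall z, U' z -> U (drop_last z)) -> (forall w, V' w -> V (drop_last w)) ->
  smooth_on U' x -> smooth_on V' y -> smooth_on U' mu' -> smooth_on U' tau2 ->
  (forall z, U' z -> V' (phi' z) /\ y (phi' z) = last_coord z) ->
  (forall w, V' w -> U' (psi' w) /\ x (psi' w) = last_coord w) ->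
  (forall z, U' z -> mu' z != 0) ->
  (forall z, U' z -> lie tau'.1 x z != 0) ->
  (forall z, U' z -> 'd phi (drop_last z) (drop_last (tau2 z)) =
     mu' z *: drop_last (kappa2 (phi' z)) /\
     last_coord (kappa2 (phi' z)) = 0) ->
  feedback_chart tau' (ddx ord_max, kappa2) phi' psi' mu'
    (lie tau'.1 x) (lie tau'.2 x) U' V'.
Proof.
move=> tau' phi' psi' oU oV UU VV Cx Cy Cmu Ctau phiV psiU mu0 nu0 push.
have Ctau1 : smooth_on U' tau'.1 by move=> k; exact: Ck_on_cst.
have dphi z v : U' z -> 'd phi' z v =
    append_coord ('d phi (drop_last z) (drop_last v)) ('D_v x z).
  move=> Uz; have dp := smooth_differentiable (fc_smooth_phi C) (UU _ Uz).
  have [d1 d2] := derive_append v (differentiable_comp_drop dp)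
    (smooth_differentiable Cx Uz).
  by rewrite -deriveE // d2 derive_comp_drop // deriveE.
split=> //.
- by move=> z /phiV[].
- by move=> w /psiU[].
- move=> z Uz; apply: eq_drop_last; rewrite /psi' /phi' !append_coordE.
    exact: (fc_phiK C (UU _ Uz)).
  by have [] := phiV z Uz.
- move=> w Vw; apply: eq_drop_last; rewrite /psi' /phi' !append_coordE.
    exact: (fc_psiK C (VV _ Vw)).
  by have [] := psiU w Vw.
- move=> k; apply: Ck_on_append (Cx k) => //.
  apply/(Ck_on_rowP _ _ oU) => i.
  exact: Ck_on_comp_drop oU UU (proj1 (Ck_on_rowP k phi (fc_openU C))
    (fc_smooth_phi C k) i).
- move=> k; apply: Ck_on_append (Cy k) => //.
  apply/(Ck_on_rowP _ _ oV) => i.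
  exact: Ck_on_comp_drop oV VV (proj1 (Ck_on_rowP k psi (fc_openV C))
    (fc_smooth_psi C k) i).
- by move=> k; exact: Ck_on_lie oU (Ctau1 k) (Cx k.+1).
- by move=> k; exact: Ck_on_lie oU (Ctau k) (Cx k.+1).
- move=> z Uz; rewrite dphi //; apply: eq_drop_last; rewrite !append_coordE.
    by rewrite linear0 scaler0.
  by rewrite mulr1.
- move=> z Uz; rewrite dphi //; have [p1 p2] := push z Uz.
  apply: eq_drop_last; rewrite !append_coordE.
    by rewrite p1 scaler0 add0r.
  by rewrite mulr1 p2 mulr0 addr0.
Qed.

End Prolongation.

(** * The trailer step, in the regular and singular cases *)

Section TrailerStep.
Variables (R : realType) (m : nat) (tau kappa : vfpair R m.+1).
Variables (phi psi : 'rV[R]_m.+1 -> 'rV[R]_m.+1) (mu nu eta : 'rV[R]_m.+1 -> R).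
Variables (U V : set 'rV[R]_m.+1) (r : 'rV[R]_m.+1 -> R) (th : R).
Hypothesis C : feedback_chart tau kappa phi psi mu nu eta U V.
Hypothesis Cr : smooth_on U r.

(* [r] is the previous angle, or 0 at the first step of the construction. *)
Definition angle_from (z : 'rV[R]_m.+2) : R := last_coord z - r (drop_last z).
Let s z := sin (angle_from z).
Let c z := cos (angle_from z).
Let tau2 : vfield R m.+2 := fun z =>
  s z *: vlift tau.1 z + c z *: vlift tau.2 z.
Let a z := c z * mu (drop_last z).
Let b z := s z * nu (drop_last z) + c z * eta (drop_last z).
Let U0 : set 'rV[R]_m.+2 := [set z | U (drop_last z)].
Let V0 : set 'rV[R]_m.+2 := [set w | V (drop_last w)].
(** The window of width pi centred at [th], on which the arctangent inverts the tangent of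
    [angle_from z - th]. *)
Let U1 : set 'rV[R]_m.+2 :=
  [set z | U0 z /\ (th - pi / 2 < angle_from z < th + pi / 2)%R].
Let q (w : 'rV[R]_m.+2) := psi (drop_last w).

Let open_drop (W : set 'rV[R]_m.+1) : open W ->
  open [set z : 'rV[R]_m.+2 | W (drop_last z)].
Proof.
move=> oW; rewrite (_ : [set z | _] =
  [set z | [set: 'rV[R]_m.+2] z /\ W (drop_last z)]).
  apply: open_smooth_preimage oW => [|k];
    [exact: openT|exact/Ck_on_drop_last/openT].
by apply/seteqP; split=> z //= [].
Qed.

Let oU0 : open U0. Proof. exact: open_drop (fc_openU C). Qed.
Let oV0 : open V0. Proof. exact: open_drop (fc_openV C). Qed.

Let smooth_drop (f : 'rV[R]_m.+1 -> R) :
  smooth_on U f -> smooth_on U0 (fun z => f (drop_last z)).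
Proof. by move=> Cf k; apply: Ck_on_comp_drop (Cf k). Qed.

Let smooth_angle : smooth_on U0 angle_from.
Proof.
by move=> k; apply: Ck_onB => //; [exact: Ck_on_last_coord|exact: smooth_drop].
Qed.

Let smooth_s : smooth_on U0 s.
Proof. by move=> k; have [] := Ck_on_sin_cos oU0 (smooth_angle k). Qed.

Let smooth_c : smooth_on U0 c.
Proof. by move=> k; have [] := Ck_on_sin_cos oU0 (smooth_angle k). Qed.

Let smooth_a : smooth_on U0 a.
Proof.
by move=> k; apply: Ck_onM => //; apply: smooth_drop; exact: fc_smooth_mu C.
Qed.

Let smooth_b : smooth_on U0 b.
Proof.
move=> k; apply: Ck_onD => //; apply: Ck_onM => //; apply: smooth_drop.
  exact: fc_smooth_nu C.
exact: fc_smooth_eta C.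
Qed.

Let smooth_tau2 : smooth_on U0 tau2.
Proof.
move=> k; apply/(Ck_on_rowP _ _ oU0) => i.
have Ct1 := proj1 (Ck_on_rowP k _ (fc_openU C)) (fc_smooth_tau1 C k).
have Ct2 := proj1 (Ck_on_rowP k _ (fc_openU C)) (fc_smooth_tau2 C k).
case: (unliftP ord_max i) => [j ->|->].
  apply: eq_Ck_on (Ck_onD oU0
    (Ck_onM oU0 (smooth_s k) (Ck_on_comp_drop oU0 (fun z Uz => Uz) (Ct1 j)))
    (Ck_onM oU0 (smooth_c k) (Ck_on_comp_drop oU0 (fun z Uz => Uz) (Ct2 j)))) =>
      // z _.
  by rewrite !mxE liftK.
apply: eq_Ck_on (Ck_on_cst k U0 (0 : R)) => // z _.
by rewrite !mxE unlift_none /= !mulr0 addr0.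
Qed.

Let e : 'rV[R]_m.+2 := ddx ord_max 0.

Let is_derive_drop (f : 'rV[R]_m.+1 -> R) z : smooth_on U f -> U0 z ->
  is_derive z e (fun z => f (drop_last z)) 0.
Proof.
move=> Cf Uz; have df := smooth_differentiable Cf Uz.
apply: DeriveDef; first exact/diff_derivable/differentiable_comp_drop.
by rewrite derive_comp_drop // drop_last_ddx_max derive0.
Qed.

Let is_derive_angle z : U0 z -> is_derive z e angle_from 1.
Proof.
move=> Uz; have df := smooth_differentiable smooth_angle Uz.
apply: DeriveDef; first exact: diff_derivable.
have [d1 d2] := is_derive_drop Cr Uz.
rewrite (@deriveB _ _ _ (@last_coord R m.+1) (fun z => r (drop_last z))) //;
  last first.
  exact/diff_derivable/differentiable_coord.
by rewrite d2 derive_last_coord last_coord_ddx_max subr0.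
Qed.

Let is_derive_s z : U0 z -> is_derive z e s (c z).
Proof.
move=> Uz; have [_ de] := is_derive_angle Uz.
have [ds dE] := diff_comp1 (smooth_differentiable smooth_angle Uz)
  (is_derive_sin (angle_from z)).
apply: DeriveDef; first exact: diff_derivable.
by rewrite [LHS]dE de mulr1.
Qed.

Let is_derive_c z : U0 z -> is_derive z e c (- s z).
Proof.
move=> Uz; have [_ de] := is_derive_angle Uz.
have [ds dE] := diff_comp1 (smooth_differentiable smooth_angle Uz)
  (is_derive_cos (angle_from z)).
apply: DeriveDef; first exact: diff_derivable.
by rewrite [LHS]dE de mulr1.
Qed.

Let derive_a z : U0 z -> 'D_e a z = - s z * mu (drop_last z).
Proof.
move=> Uz; have [_ dE] := is_deriveM (is_derive_c Uz)
  (is_derive_drop (fc_smooth_mu C) Uz).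
by rewrite [LHS]dE scaler0 add0r /GRing.scale /= mulrC.
Qed.

Let derive_b z : U0 z ->
  'D_e b z = c z * nu (drop_last z) - s z * eta (drop_last z).
Proof.
move=> Uz; have [_ dE] := is_deriveD
  (is_deriveM (is_derive_s Uz) (is_derive_drop (fc_smooth_nu C) Uz))
  (is_deriveM (is_derive_c Uz) (is_derive_drop (fc_smooth_eta C) Uz)).
rewrite [LHS]dE !scaler0 !add0r /GRing.scale /=; ring.
Qed.

(** In the numerator of the quotient rule the [eta] terms cancel, and the rest is [nu * mu] times
    the sum of the squares of [c] and [s]. So the new [nu] inherits nonvanishing from the old [nu]
    and [mu]. *)
Lemma lie_regular z : U (drop_last z) -> a z != 0 ->
  lie (ddx ord_max) (fun z => b z / a z) z =
    nu (drop_last z) * mu (drop_last z) / a z ^+ 2.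
Proof.
move=> Uz a0; rewrite /lie derive_div //; last 2 first.
- exact/diff_derivable/(smooth_differentiable smooth_b Uz).
- exact/diff_derivable/(smooth_differentiable smooth_a Uz).
rewrite -/e derive_a // derive_b //; congr (_ / _).
have := cos2Dsin2 (angle_from z); rewrite -/(c z) -/(s z) => cs.
transitivity (nu (drop_last z) * mu (drop_last z) * (c z ^+ 2 + s z ^+ 2)).
  by rewrite /a /b; ring.
by rewrite cs mulr1.
Qed.

(** The same numerator with the opposite sign, numerator and denominator being exchanged. *)
Lemma lie_singular z : U (drop_last z) -> b z != 0 ->
  lie (ddx ord_max) (fun z => a z / b z) z =
    - (nu (drop_last z) * mu (drop_last z)) / b z ^+ 2.
Proof.
move=> Uz b0; rewrite /lie derive_div //; last 2 first.
- exact/diff_derivable/(smooth_differentiable smooth_a Uz).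
- exact/diff_derivable/(smooth_differentiable smooth_b Uz).
rewrite -/e derive_a // derive_b //; congr (_ / _).
have := cos2Dsin2 (angle_from z); rewrite -/(c z) -/(s z) => cs.
transitivity (- (nu (drop_last z) * mu (drop_last z)) * (c z ^+ 2 + s z ^+ 2)).
  by rewrite /a /b; ring.
by rewrite cs mulr1.
Qed.

Let oU1 : open U1.
Proof.
apply: (open_smooth_preimage (A := [set t | th - pi / 2 < t < th + pi / 2])) =>
  //.
rewrite (_ : [set t | _] = `]th - pi / 2, th + pi / 2[%classic);
  first exact: interval_open.
by apply/seteqP; split => t; rewrite /= in_itv.
Qed.

Let push2 z : U0 z -> 'd phi (drop_last z) (drop_last (tau2 z)) =
  b z *: kappa.1 (phi (drop_last z)) + a z *: kappa.2 (phi (drop_last z)).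
Proof.
move=> Uz; rewrite /tau2 /vlift !append_coordE linearD !linearZ /=.
by rewrite (fc_push1 C) // (fc_push2 C) // scalerDr !scalerA addrA -scalerDl.
Qed.

Let angle_bound z : U1 z ->
  0 < cos (angle_from z - th) /\
  atan (tan (angle_from z - th)) = angle_from z - th.
Proof.
move=> [_ /andP[lo hi]].
have bnd : - (pi / 2) < angle_from z - th < pi / 2 by apply/andP; split; lra.
by split; [exact: cos_gt0_pihalf|rewrite tanK // in_itv].
Qed.

Let angle_atan x :
  th - pi / 2 < th + atan x < th + pi / 2.
Proof. by rewrite !ltrD2l atan_ltpi2 atan_gtNpi2. Qed.

Let q_V w : V0 w -> U (q w). Proof. exact: (fc_psi C). Qed.

Let smooth_q (f : 'rV[R]_m.+1 -> R) :
  smooth_on U f -> smooth_on V0 (fun w => f (q w)).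
Proof.
move=> Cf k; apply: (Ck_on_comp oV0 q_V (Cf k)).
apply/(Ck_on_rowP _ _ oV0) => i.
exact: Ck_on_comp_drop oV0 (fun w Vw => Vw)
  (proj1 (Ck_on_rowP k psi (fc_openV C)) (fc_smooth_psi C k) i).
Qed.

(* [th] satisfies [sin th = 0] in the regular case and [cos th = 0] in the
   singular case, so [tan (angle_from z - th)] is [s z / c z] in the former and
   [- (c z / s z)] in the latter. *)
Let regular_last (w : 'rV[R]_m.+2) : R :=
  r (q w) + (th + atan ((last_coord w * mu (q w) - eta (q w)) / nu (q w))).

Let singular_last (w : 'rV[R]_m.+2) : R :=
  r (q w) + (th -
    atan (nu (q w) * last_coord w / (mu (q w) - last_coord w * eta (q w)))).

(** In the singular case the [eta] term can make [b] vanish inside the window. The condition in [V2]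
    is the counterpart of [b z != 0]: both express that a denominator, of [a / b] or of its inverse
    formula, is nonzero. *)
Let U2 : set 'rV[R]_m.+2 := [set z | U1 z /\ b z != 0].
Let V2 : set 'rV[R]_m.+2 :=
  [set w | V0 w /\ mu (q w) - last_coord w * eta (q w) != 0].

(** On the window [c] has no zero, hence neither has [a]. The last target coordinate is
    unrestricted, since the arctangent accepts every real number. *)
Lemma regular_feedback_chart : sin th = 0 ->
  feedback_chart (ddx ord_max, tau2) (regular_prolongation 0 kappa)
    (fun z => append_coord (phi (drop_last z)) (b z / a z))
    (fun w => append_coord (psi (drop_last w)) (regular_last w)) a
    (lie (ddx ord_max) (fun z => b z / a z))
    (lie tau2 (fun z => b z / a z)) U1 V0.
Proof.
move=> sth.
have cth : cos th != 0.
  apply/eqP => cth; have := cos2Dsin2 th; rewrite sth cth expr0n addr0 => /eqP.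
  by rewrite eq_sym oner_eq0.
have UU z : U1 z -> U (drop_last z) by case.
have sub (f : 'rV[R]_m.+2 -> R) k : Ck_on k U0 f -> Ck_on k U1 f.
  by apply: Ck_on_sub => z [].
have cE z : c z = cos th * cos (angle_from z - th).
  by rewrite /c -[in LHS](subrK th (angle_from z))
    [LHS]cosD sth mulr0 subr0 mulrC.
have sE z : s z = cos th * sin (angle_from z - th).
  by rewrite /s -[in LHS](subrK th (angle_from z))
    [LHS]sinD sth mulr0 addr0 mulrC.
have c0 z : U1 z -> c z != 0.
  by move=> /angle_bound[ct _]; rewrite cE mulf_neq0 // lt0r_neq0.
have a0 z : U1 z -> a z != 0.
  by move=> Uz; rewrite mulf_neq0 ?c0 ?(fc_mu_neq0 C) //; exact: UU.
apply: (append_feedback_chart C) => //.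
- by move=> k; apply: Ck_on_div => //; exact: sub.
- move=> k; apply: Ck_onD => //; first exact: smooth_q.
  apply: Ck_onD => //; first exact: Ck_on_cst.
  apply: Ck_on_atan => //; apply: Ck_on_div => //.
  + by move=> w Vw; apply: (fc_nu_neq0 C); exact: q_V.
  + apply: Ck_onB => //; last by apply: smooth_q; exact: fc_smooth_eta C.
    apply: Ck_onM => //; first exact: Ck_on_last_coord.
    by apply: smooth_q; exact: fc_smooth_mu C.
  + by apply: smooth_q; exact: fc_smooth_nu C.
- by move=> k; exact: sub.
- by move=> k; apply: Ck_on_sub (smooth_tau2 k) => z [].
- move=> z Uz; rewrite /V0 /= append_coordK; split.
    by apply: (fc_phi C); exact: UU.
  have [ct tK] := angle_bound Uz.
  rewrite /regular_last /q !append_coordE (fc_phiK C (UU _ Uz)).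
  (* Solving x = b / a for the tangent: x mu = (s / c) nu + eta. *)
  have -> : (b z / a z * mu (drop_last z) - eta (drop_last z)) /
      nu (drop_last z) = tan (angle_from z - th).
    have := c0 z Uz; have mu0 := fc_mu_neq0 C (UU _ Uz).
    have nu0 := fc_nu_neq0 C (UU _ Uz).
    rewrite /b /a /tan cE sE => ?; field.
    by rewrite mu0 nu0 cth lt0r_neq0.
  by rewrite tK /angle_from; ring.
- move=> w Vw; have Uq := q_V Vw.
  have mu0 := fc_mu_neq0 C Uq; have nu0 := fc_nu_neq0 C Uq.
  set z := append_coord _ _.
  have zq : drop_last z = q w by rewrite append_coordK.
  have az : angle_from z = th +
    atan ((last_coord w * mu (q w) - eta (q w)) / nu (q w)).
    by rewrite /angle_from zq last_append_coord /regular_last addrC addKr.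
  have U1z : U1 z by split; rewrite /U0 /= ?zq // az angle_atan.
  split=> //; have [ct _] := angle_bound U1z.
  have tE : tan (angle_from z - th) =
    (last_coord w * mu (q w) - eta (q w)) / nu (q w).
    by rewrite az addrAC subrr add0r atanK.
  (* Substituting s in terms of c turns b / a back into the last coordinate of [w]. *)
  have {}sE : s z = c z * ((last_coord w * mu (q w) - eta (q w)) / nu (q w)).
    by rewrite -tE sE cE /tan mulrA mulrAC mulfK // lt0r_neq0.
  rewrite /b /a zq sE; field.
  by rewrite mu0 nu0 c0.
- move=> z Uz; rewrite lie_regular ?a0 //; last exact: UU.
  by rewrite mulf_neq0 ?invr_neq0 ?expf_neq0 ?a0 // mulf_neq0 //
    ?(fc_nu_neq0 C) ?(fc_mu_neq0 C) //; exact: UU.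
- move=> z Uz; rewrite push2; last exact: UU.
  rewrite /regular_prolongation /vlift /= !append_coordE addr0.
  split; last by rewrite !mulr0 addr0.
  by rewrite scalerDr scalerA mulrC divfK ?a0.
Qed.

(** On the window [s] has no zero. The equation x = a / b gives c / s = nu x / (mu - x eta), which
    is minus the tangent of the shifted angle; hence the minus sign before the arctangent. *)
Lemma singular_feedback_chart : cos th = 0 ->
  feedback_chart (ddx ord_max, tau2) (singular_prolongation kappa)
    (fun z => append_coord (phi (drop_last z)) (a z / b z))
    (fun w => append_coord (psi (drop_last w)) (singular_last w)) b
    (lie (ddx ord_max) (fun z => a z / b z))
    (lie tau2 (fun z => a z / b z)) U2 V2.
Proof.
move=> cth.
have sth : sin th != 0.
  apply/eqP => sth; have := cos2Dsin2 th; rewrite sth cth expr0n addr0 => /eqP.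
  by rewrite eq_sym oner_eq0.
have UU z : U2 z -> U (drop_last z) by case=> [[]].
have sub (f : 'rV[R]_m.+2 -> R) k : Ck_on k U0 f -> Ck_on k U2 f.
  by apply: Ck_on_sub => z [[]].
have subV (f : 'rV[R]_m.+2 -> R) k : Ck_on k V0 f -> Ck_on k V2 f.
  by apply: Ck_on_sub => z [].
have cE z : c z = - (sin th * sin (angle_from z - th)).
  by rewrite /c -[in LHS](subrK th (angle_from z))
    [LHS]cosD cth mulr0 add0r mulrC.
have sE z : s z = sin th * cos (angle_from z - th).
  by rewrite /s -[in LHS](subrK th (angle_from z))
    [LHS]sinD cth mulr0 add0r mulrC.
have s0 z : U1 z -> s z != 0.
  by move=> /angle_bound[ct _]; rewrite sE mulf_neq0 // lt0r_neq0.
have smooth_den : smooth_on V0 (fun w => mu (q w) - last_coord w * eta (q w)).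
  move=> k; apply: Ck_onB => //; first by apply: smooth_q;
    exact: fc_smooth_mu C.
  apply: Ck_onM => //; first exact: Ck_on_last_coord.
  by apply: smooth_q; exact: fc_smooth_eta C.
have onz : open [set t : R | t != 0] by exact: open_neq.
have oU2 : open U2.
  apply: (open_smooth_preimage (A := [set t | t != 0])) => // k.
  by apply: Ck_on_sub (smooth_b k) => z [].
have oV2 : open V2 by exact: (open_smooth_preimage (A := [set t | t != 0])).
apply: (append_feedback_chart C) => //.
- by move=> w [].
- by move=> k; apply: Ck_on_div => //; [by move=> z []|exact: sub|exact: sub].
- move=> k; apply: Ck_onD => //; first exact/subV/smooth_q.
  apply: Ck_onB => //; first exact: Ck_on_cst.
  apply: Ck_on_atan => //; apply: Ck_on_div => //; first by move=> w [].
  + apply: Ck_onM => //; last exact: Ck_on_last_coord.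
    by apply: subV; apply: smooth_q; exact: fc_smooth_nu C.
  + exact: subV.
- by move=> k; exact: sub.
- by move=> k; apply: Ck_on_sub (smooth_tau2 k) => z [[]].
- move=> z Uz; have [U1z b0] := Uz; have [ct tK] := angle_bound U1z.
  have mu0 := fc_mu_neq0 C (UU _ Uz); have nu0 := fc_nu_neq0 C (UU _ Uz).
  (* As b - c eta = s nu, the denominator of the inverse formula is a product of nonzero factors, so
     the image lies in [V2]. *)
  have den : mu (drop_last z) - a z / b z * eta (drop_last z) =
      mu (drop_last z) * s z * nu (drop_last z) / b z.
    by move: b0; rewrite /a /b => b0; field.
  rewrite /V2 /V0 /singular_last /q /= !append_coordE (fc_phiK C (UU _ Uz)) den.
  split; first split; first by apply: (fc_phi C); exact: UU.
    by rewrite mulf_neq0 ?invr_neq0 // !mulf_neq0 ?s0.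
  have -> : nu (drop_last z) * (a z / b z) /
      (mu (drop_last z) * s z * nu (drop_last z) / b z) =
      - tan (angle_from z - th).
    have := s0 z U1z; rewrite /a /tan cE sE => ?; field.
    by rewrite mu0 nu0 sth b0 lt0r_neq0.
  by rewrite atanN opprK tK /angle_from; ring.
- move=> w [Vw den0]; have Uq := q_V Vw.
  have mu0 := fc_mu_neq0 C Uq; have nu0 := fc_nu_neq0 C Uq.
  set z := append_coord _ _.
  set T := nu (q w) * last_coord w / (mu (q w) - last_coord w * eta (q w)).
  have zq : drop_last z = q w by rewrite append_coordK.
  have az : angle_from z = th + atan (- T).
    by rewrite atanN /angle_from zq last_append_coord /singular_last addrC
      addKr.
  have U1z : U1 z by split; rewrite /U0 /= ?zq // az angle_atan.
  have [ct _] := angle_bound U1z.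
  have tE : tan (angle_from z - th) = - T.
    by rewrite az addrAC subrr add0r atanK.
  have {}cE : c z = s z * T.
    rewrite -[T]opprK -tE sE cE /tan; field; exact: lt0r_neq0.
  (* With c = s T, b is s (nu + T eta); this form shows that [b z] is nonzero, so the preimage lies
     in [U2]. *)
  have bE : b z = s z * nu (q w) * mu (q w) /
      (mu (q w) - last_coord w * eta (q w)).
    by rewrite /b zq cE /T; field.
  have sz := s0 z U1z.
  have b0 : b z != 0 by rewrite bE mulf_neq0 ?invr_neq0 // !mulf_neq0.
  split=> //; rewrite bE /a zq cE /T; field.
  by rewrite mu0 nu0 sz den0.
- by move=> z [].
- move=> z [[Uz _] b0]; rewrite lie_singular //.
  by rewrite mulf_neq0 ?invr_neq0 ?expf_neq0 // oppr_eq0 mulf_neq0 //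
    ?(fc_nu_neq0 C) ?(fc_mu_neq0 C).
- move=> z Uz; rewrite push2; last exact: UU.
  rewrite /singular_prolongation /vlift /= !append_coordE.
  split; last by rewrite !mulr0 addr0.
  have [_ b0] := Uz.
  by rewrite scalerDr scalerA [b z * _]mulrC divfK.
Qed.

End TrailerStep.

(** * Zeros of the cosine, and changing coefficients on the domain of a chart *)

Lemma cos_eq0_pm_half_pi (R : realType) (x : R) : cos x = 0 -> pm_half_pi x.
Proof.
move=> cx; have pi0 := pi_gt0 R.
have p2 : (0 : R) < pi *+ 2 by rewrite pmulrn_lgt0.
(* This [k] brings [x] into the period from - pi / 2 (included) to 3 pi / 2 (excluded). The cosine
   is positive on the first open half and negative on the second, which leaves the two left ends of
   these halves. *)
pose k := Num.floor ((x + pi / 2) / (pi *+ 2)).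
have [lo hi] : k%:~R * (pi *+ 2) <= x + pi / 2 /\
    x + pi / 2 < (k + 1)%:~R * (pi *+ 2).
  split; first by rewrite -ler_pdivlMr // ge_floor.
  by rewrite -ltr_pdivrMr // floorD1_gt.
have cy : cos (x - k%:~R * (pi *+ 2)) = 0.
  by rewrite -mulNr -mulrNz cos_2pi_int.
have xE : x = (x - k%:~R * (pi *+ 2)) + k%:~R * (pi *+ 2) by rewrite subrK.
move: lo hi cy xE; rewrite intrD mulr1z (mulrDl _ 1) mul1r mulr2n.
set y := x - _ => lo hi cy xE; exists k.
have ylo : - (pi / 2) <= y by rewrite /y; lra.
have yhi : y < pi / 2 + pi by rewrite /y; lra.
have [yl|yg|yE] := ltgtP y (pi / 2); last by left; rewrite xE yE.
  have [yl'|] := ltP (- (pi / 2)) y.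
    by have := @cos_gt0_pihalf R y; rewrite yl' yl cy ltxx => /(_ isT).
  by move=> yle; right; rewrite xE; congr (_ + _); apply/eqP;
    rewrite eq_le yle ylo.
have := @cos_gt0_pihalf R (y - pi).
rewrite cosB cospi sinpi cy mul0r mulr0 add0r ltxx => H.
by have : false by apply: H; apply/andP; split; lra.
Qed.

Lemma pm_half_pi_cos (R : realType) (x : R) : pm_half_pi x -> cos x = 0.
Proof.
by case=> k [->|->]; rewrite cos_2pi_int ?cosN cos_pihalf.
Qed.

(** The difference quotient is identically zero, because the last coordinate stays fixed along
    [v]. *)
Lemma derive_comp_last_coord (R : realType) m (g : R -> R) (z v : 'rV[R]_m.+1) :
  last_coord v = 0 -> 'D_v (fun z => g (last_coord z)) z = 0.
Proof.
move=> v0; rewrite /derive (_ : (fun h => _) = cst 0) ?lim_cst //.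
by apply/funext => h /=; rewrite last_coordD last_coordZ v0 mulr0 add0r subrr
  scaler0.
Qed.

(** Used at the start, where nu_0 and eta_0 are prescribed by formulas that match the Lie
    derivatives on the domain. *)
Lemma eq_feedback_chart (R : realType) m (tau kappa : vfpair R m.+1)
    phi psi mu nu eta nu' eta' U V :
  {in U, nu =1 nu'} -> {in U, eta =1 eta'} ->
  feedback_chart tau kappa phi psi mu nu eta U V ->
  feedback_chart tau kappa phi psi mu nu' eta' U V.
Proof.
move=> enu eeta [oU oV pU pV pK pK' Cp Cq Cm Cn Ce Ct1 Ct2 m0 n0 p1 p2].
split=> //.
- by move=> k; exact: eq_Ck_on (Cn k).
- by move=> k; exact: eq_Ck_on (Ce k).
- by move=> z Uz; rewrite -enu ?inE//; exact: n0.
- by move=> z Uz; rewrite -enu ?inE//; exact: p1.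
- by move=> z Uz; rewrite -eeta ?inE//; exact: p2.
Qed.

(** * Permutations of coordinates as charts between constant frames *)

Section ReindexChart.
Variables (R : realType) (m : nat) (sg : 'I_m.+1 -> 'I_m.+1).
Hypothesis sgK : involutive sg.

Definition reindex_row (x : 'rV[R]_m.+1) : 'rV[R]_m.+1 := \row_j x 0 (sg j).

Lemma reindex_rowK : involutive reindex_row.
Proof. by move=> x; apply/rowP => j; rewrite !mxE sgK. Qed.

Lemma smooth_reindex_row : smooth_on setT reindex_row.
Proof.
move=> k; apply/(Ck_on_rowP _ _ openT) => i.
by apply: eq_Ck_on (Ck_on_coord k setT (sg i)) => [|z _];
  [exact: openT|rewrite mxE].
Qed.

Lemma diff_reindex_row z j :
  'd reindex_row z (ddx j z) = ddx (sg j) (reindex_row z).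
Proof.
have dz := smooth_differentiable smooth_reindex_row (I : setT z).
rewrite -deriveE //; apply/rowP => i; rewrite derive_row //.
rewrite (_ : (fun z => _) = (fun z : 'rV[R]_m.+1 => z 0 (sg i))); last first.
  by apply/funext => w; rewrite mxE.
by rewrite derive_coord !mxE /= -{1}(sgK j) (can_eq sgK).
Qed.

Lemma reindex_feedback_chart j1 j2 :
  feedback_chart (ddx j1, ddx j2) (ddx (sg j1), ddx (sg j2))
    reindex_row reindex_row (fun=> 1) (fun=> 1) (fun=> 0) setT setT.
Proof.
have Cc (V : normedModType R) (a : V) : smooth_on setT (fun=> a : V).
  by move=> k; exact: Ck_on_cst.
have oT : open [set: 'rV[R]_m.+1] := openT.
split=> //; try exact: smooth_reindex_row.
- by move=> z _; exact: reindex_rowK.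
- by move=> z _; exact: reindex_rowK.
- exact: Cc.
- exact: Cc.
- by move=> z _; rewrite diff_reindex_row scale1r.
- by move=> z _; rewrite diff_reindex_row scale0r add0r scale1r.
Qed.

End ReindexChart.

(** * Choosing the window so that each step has a chart around a given point *)

Section StepExists.
Variables (R : realType) (m : nat) (tau kappa : vfpair R m.+1).
Variables (phi psi : 'rV[R]_m.+1 -> 'rV[R]_m.+1) (mu nu eta : 'rV[R]_m.+1 -> R).
Variables (U V : set 'rV[R]_m.+1) (r : 'rV[R]_m.+1 -> R) (p : 'rV[R]_m.+2).
Hypothesis C : feedback_chart tau kappa phi psi mu nu eta U V.
Hypothesis Cr : smooth_on U r.
Hypothesis Up : U (drop_last p).

Let s z := sin (angle_from r z).
Let c z := cos (angle_from r z).
Let tau2 : vfield R m.+2 := fun z =>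
  s z *: vlift tau.1 z + c z *: vlift tau.2 z.
Let a z := c z * mu (drop_last z).
Let b z := s z * nu (drop_last z) + c z * eta (drop_last z).

Lemma regular_chart_exists : ~ pm_half_pi (angle_from r p) ->
  exists psi' U' V',
  feedback_chart (ddx ord_max, tau2) (regular_prolongation 0 kappa)
    (fun z => append_coord (phi (drop_last z)) (b z / a z)) psi' a
    (lie (ddx ord_max) (fun z => b z / a z))
    (lie tau2 (fun z => b z / a z)) U' V' /\ U' p.
Proof.
move=> hp; have cp : cos (angle_from r p) != 0.
  by apply/eqP => /cos_eq0_pm_half_pi.
(* [angle_from r p - al] is the zero of [sin] nearest to [angle_from r p]. *)
pose al := atan (tan (angle_from r p)).
have cal : cos al != 0.
  by apply/lt0r_neq0/cos_gt0_pihalf; rewrite atan_gtNpi2 atan_ltpi2.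
have sth : sin (angle_from r p - al) = 0.
  have : tan al = tan (angle_from r p) by exact: atanK.
  rewrite {1}/tan => /(canRL (divfK cal)) sE.
  by rewrite sinB sE /tan; field.
have Cr' := regular_feedback_chart C Cr sth.
do 3 eexists; split; first exact: Cr'.
(* The given angle differs from the centre of the window by [al], which is strictly between - pi / 2
   and pi / 2. *)
split=> //; have := atan_ltpi2 (tan (angle_from r p)).
have := atan_gtNpi2 (tan (angle_from r p)); rewrite -/al => h1 h2.
by apply/andP; split; lra.
Qed.

Lemma singular_chart_exists : pm_half_pi (angle_from r p) ->
  exists psi' U' V',
  feedback_chart (ddx ord_max, tau2) (singular_prolongation kappa)
    (fun z => append_coord (phi (drop_last z)) (a z / b z)) psi' b
    (lie (ddx ord_max) (fun z => a z / b z))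
    (lie tau2 (fun z => a z / b z)) U' V' /\ U' p.
Proof.
move=> /pm_half_pi_cos cp.
(* Here the angle at [p] itself has zero cosine and serves as the centre of the window. *)
have Cr' := singular_feedback_chart C Cr cp.
do 3 eexists; split; first exact: Cr'.
split; first split=> //.
  by have := pi_gt0 R => pi0; apply/andP; split; lra.
(* At [p] the [eta] term of [b] disappears with the cosine, leaving the sine, which is nonzero
   there, times [nu]. *)
rewrite cp mul0r addr0 mulf_neq0 ?(fc_nu_neq0 C) //.
apply/eqP => sp; have := cos2Dsin2 (angle_from r p).
rewrite sp cp expr0n addr0 => /eqP.
by rewrite eq_sym oner_eq0.
Qed.

End StepExists.

(** * The initial system, and the induction on the number of trailers *)

Lemma row3_append (R : realType) (a b c : R) (x : 'rV[R]_2) :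
  x 0 0 = a -> x 0 1 = b -> row3 a b c = append_coord x c.
Proof.
move=> <- <-; apply/rowP => j; rewrite !mxE.
case: (unliftP ord_max j) => [i ->|->] //=.
by rewrite /bump leqNgt ltn_ord add0n; case: i => [[|[|//]] hi] /=;
  congr (x 0 _); exact: val_inj.
Qed.

Lemma vlift_ddx (R : realType) m (j : 'I_m) :
  vlift (ddx (R := R) j) = ddx (lift ord_max j).
Proof.
apply/funext => z; apply/rowP => i; rewrite !mxE /=.
case: (unliftP ord_max i) => [k ->|->] /=.
  by rewrite mxE /= (inj_eq lift_inj).
by rewrite (negPf (neq_lift _ _)).
Qed.

Lemma kappa3_regular (R : realType) :
  regular_prolongation 0 (ddx 1, ddx 0) = kappa3 R.
Proof.
rewrite /regular_prolongation /kappa3 /= !vlift_ddx.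
have -> : lift ord_max 1 = 1 :> 'I_3 by exact: val_inj.
have -> : lift ord_max 0 = 0 :> 'I_3 by exact: val_inj.
by congr (_, _); apply/funext => x; rewrite addr0.
Qed.

(** Swapping the two fields of the plane frame compensates for replacing the regular prolongation by
    the singular one, so both starting cases end in the same [kappa3]. *)
Lemma kappa3_singular (R : realType) :
  singular_prolongation (ddx 0, ddx 1) = kappa3 R.
Proof.
rewrite /singular_prolongation /kappa3 /= !vlift_ddx.
have -> : lift ord_max 1 = 1 :> 'I_3 by exact: val_inj.
have -> : lift ord_max 0 = 0 :> 'I_3 by exact: val_inj.
by congr (_, _); apply/funext => x; rewrite addrC.
Qed.

Lemma nform0_chart (R : realType) (p : 'rV[R]_3) :
  exists psi U V, feedback_chart (trailer R 0) (kappa3 R) (nf_phi (nform0 p))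
    psi (nf_mu (nform0 p)) (nf_nu (nform0 p)) (nf_eta (nform0 p)) U V /\ U p.
Proof.
have C0 : smooth_on [set: 'rV[R]_2] (fun=> 0 : R) by move=> k; exact: Ck_on_cst.
have aE : angle_from (fun=> 0) = @last_coord R 2.
  by apply/funext => z; rewrite /angle_from subr0.
have tE (g h : R -> R) :
    (fun z => g (angle_from (fun=> 0) z) *: vlift (ddx 1) z +
              h (angle_from (fun=> 0) z) *: vlift (ddx 0) z) =
    (fun z : 'rV[R]_3 => g (last_coord z) *: ddx 1 z +
                         h (last_coord z) *: ddx 0 z).
  apply/funext => z; rewrite aE !vlift_ddx.
  have -> : lift ord_max 1 = 1 :> 'I_3 by exact: val_inj.
  by have -> : lift ord_max 0 = 0 :> 'I_3 by exact: val_inj.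
(* The field tau_2^0 has no theta_0 component, so functions of theta_0 alone are constant along
   it. *)
have eta0 g z : lie (trailer R 0).2 (fun z => g (last_coord z)) z = 0.
  apply: derive_comp_last_coord.
  by rewrite /= !append_coordE /last_coord !mxE !andbF /= !mulr0 addr0.
rewrite /nform0; case: asboolP => hp /=.
  pose C := reindex_feedback_chart R (sg := @id 'I_2) (fun=> erefl) 1 0.
  have [|psi [U [V [CC Up]]]] := regular_chart_exists C C0
    (I : setT (drop_last p)).
    by rewrite aE.
  exists psi, U, V; split=> //; move: CC; rewrite kappa3_regular /= tE aE => CC.
  have xE (z : 'rV[R]_3) : (sin (last_coord z) * 1 + cos (last_coord z) * 0) /
      (cos (last_coord z) * 1) = tan (last_coord z).
    by rewrite mulr0 addr0 !mulr1.
  have phiE : (fun z : 'rV[R]_3 => row3 (z 0 0) (z 0 1) (tan (last_coord z))) =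
    (fun z => append_coord (reindex_row id (drop_last z))
     ((sin (last_coord z) * 1 + cos (last_coord z) * 0) /
      (cos (last_coord z) * 1))).
    apply/funext => z; rewrite xE; apply: row3_append; rewrite !mxE;
      congr (z 0 _); exact: val_inj.
  have muE : (fun z : 'rV[R]_3 => cos (last_coord z)) =
      (fun z => cos (last_coord z) * 1).
    by apply/funext => z; rewrite mulr1.
  (* With mu = nu = 1 in the plane, [lie_regular] gives the inverse square of the cosine, the
     prescribed nu_0. *)
  rewrite phiE muE; apply: eq_feedback_chart (CC) => z; rewrite inE => Uz.
    have az := fc_mu_neq0 CC Uz.
    have := lie_regular C C0 (I : setT (drop_last z)).
    by rewrite aE => -> //; rewrite !mulr1 mul1r exprVn.
  exact: (eta0 (fun t => (sin t * 1 + cos t * 0) / (cos t * 1))).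
have {}hp : pm_half_pi (last_coord p) by exact: contrapT.
(* Reversal of two indices exchanges xi_1 and xi_2, as the cotangent start requires. *)
pose C := reindex_feedback_chart R (@rev_ordK 2) 1 0.
have [|psi [U [V [CC Up]]]] := singular_chart_exists C C0
  (I : setT (drop_last p)).
  by rewrite aE.
have r1 : rev_ord 1 = 0 :> 'I_2 by exact: val_inj.
have r0 : rev_ord 0 = 1 :> 'I_2 by exact: val_inj.
exists psi, U, V; split=> //; move: CC;
  rewrite r1 r0 kappa3_singular /= tE aE => CC.
have xE (z : 'rV[R]_3) : (cos (last_coord z) * 1) /
    (sin (last_coord z) * 1 + cos (last_coord z) * 0) =
      cos (last_coord z) / sin (last_coord z).
  by rewrite mulr0 addr0 !mulr1.
have phiE : (fun z : 'rV[R]_3 =>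
  row3 (z 0 1) (z 0 0) (cos (last_coord z) / sin (last_coord z))) =
  (fun z => append_coord (reindex_row (@rev_ord 2) (drop_last z))
   ((cos (last_coord z) * 1) /
    (sin (last_coord z) * 1 + cos (last_coord z) * 0))).
  apply/funext => z; rewrite xE; apply: row3_append; rewrite !mxE;
    congr (z 0 _); exact: val_inj.
have muE : (fun z : 'rV[R]_3 => sin (last_coord z)) =
    (fun z => sin (last_coord z) * 1 + cos (last_coord z) * 0).
  by apply/funext => z; rewrite mulr1 mulr0 addr0.
rewrite phiE muE; apply: eq_feedback_chart (CC) => z; rewrite inE => Uz.
  have bz := fc_mu_neq0 CC Uz.
  have := lie_singular C C0 (I : setT (drop_last z)).
  by rewrite aE => -> //; rewrite !mulr1 mulr0 addr0 mulNr mul1r exprVn.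
exact: (eta0 (fun t => (cos t * 1) / (sin t * 1 + cos t * 0))).
Qed.

Lemma nform_chart (R : realType) n (p : 'rV[R]_n.+3) :
  exists2 kappa, KumperaRuiz kappa &
    exists psi U V, feedback_chart (trailer R n) kappa (nf_phi (nform p)) psi
      (nf_mu (nform p)) (nf_nu (nform p)) (nf_eta (nform p)) U V /\ U p.
Proof.
elim: n p => [|n IH] p.
  by exists (kappa3 R); [exact: KR_base|exact: nform0_chart].
have [kappa KR [psi [U [V [C Up]]]]] := IH (drop_last p).
(* In the inductive step the previous angle is the last coordinate of the shorter system, so
   [angle_from] unfolds to [rel_angle]. *)
have Cl : smooth_on U (@last_coord R n.+2) by move=> k; exact: Ck_on_last_coord.
rewrite /= /nform_step; case: asboolP => hp /=.
  exists (regular_prolongation 0 kappa); first exact: KR_regular.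
  exact: regular_chart_exists C Cl Up hp.
exists (singular_prolongation kappa); first exact: KR_singular.
by apply: singular_chart_exists C Cl Up _; exact: contrapT.
Qed.

(** * Consequences of a chart: local inverses, push-forwards and trajectories *)

Lemma is_derive_comp_curve (R : realType) (V W : normedModType R) (f : V -> W)
    (z : R -> V) t w :
  is_derive t (1 : R) z w -> differentiable f (z t) ->
  is_derive t (1 : R) (f \o z) ('d f (z t) w).
Proof.
move=> [/derivable1_diffP dz zE] df.
have dfz : differentiable (f \o z) t by exact: differentiable_comp.
apply: DeriveDef; first exact: diff_derivable.
by rewrite deriveE // (diff_comp dz df) /= -zE deriveE.
Qed.

Section ChartConsequences.
Variables (R : realType) (m : nat) (tau kappa : vfpair R m.+1).
Variables (phi psi : 'rV[R]_m.+1 -> 'rV[R]_m.+1) (mu nu eta : 'rV[R]_m.+1 -> R).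
Variables (U V : set 'rV[R]_m.+1).
Hypothesis C : feedback_chart tau kappa phi psi mu nu eta U V.

Lemma feedback_chart_local_inverse p : U p -> local_inverse phi psi p.
Proof.
move=> Up; exists U, V; split.
- by split=> //; exact: fc_openU C.
- exact: fc_openV C.
- apply/seteqP; split=> [_ [z Uz <-]|x Vx]; first exact: fc_phi C _ Uz.
  by exists (psi x); [exact: (fc_psi C)|exact: (fc_psiK C)].
- by move=> z Uz; exact: (fc_phiK C).
- by split; [exact: fc_smooth_phi C|exact: fc_smooth_psi C].
Qed.

(** Here [psi'] is an arbitrary local inverse, possibly other than [psi]. Its continuity at [phi p]
    puts [psi' x] in [U] for [x] near [phi p], where the pointwise identities of the chart apply. *)
Lemma feedback_chart_push psi' p : U p -> local_inverse phi psi' p ->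
  \forall x \near phi p,
    vf_push phi psi' tau.1 x = nu (psi' x) *: kappa.1 x /\
    vf_push phi psi' tau.2 x =
      eta (psi' x) *: kappa.1 x + mu (psi' x) *: kappa.2 x.
Proof.
move=> Up [U' [V' [[oU' U'p] oV' phiUV phiK' [_ Cpsi]]]].
have Vp : V' (phi p) by rewrite -phiUV; exists p.
have psic : psi' @ phi p --> psi' (phi p) := Cpsi 0 _ Vp.
near=> x.
have Vx : V' x by near: x; exact: open_nbhs_nbhs.
have Ux : U (psi' x).
  near: x; apply: psic; rewrite phiK' //; apply: open_nbhs_nbhs.
  by split=> //; exact: fc_openU C.
have xK : phi (psi' x) = x by move: Vx; rewrite -phiUV => -[z Uz <-];
  rewrite phiK'.
by rewrite /vf_push (fc_push1 C) // (fc_push2 C) // xK.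
Unshelve. all: by end_near. Qed.

(** The chain rule applied to [psi \o phi], which is the identity near [z]. *)
Lemma diff_feedback_chartK z v : U z -> 'd psi (phi z) ('d phi z v) = v.
Proof.
move=> Uz; have dphi := smooth_differentiable (fc_smooth_phi C) Uz.
have dpsi := smooth_differentiable (fc_smooth_psi C) (fc_phi C Uz).
have near_id : {near z, id =1 psi \o phi}.
  near=> w; rewrite /= (fc_phiK C) //; near: w.
  by apply: open_nbhs_nbhs; split=> //; exact: fc_openU C.
have [did idE] := is_diff_id z.
have [_ compE] := near_eq_diff near_id did.
have := congr1 (fun f => f v) (diff_comp dphi dpsi) => /= <-.
by rewrite (congr1 (fun f => f v) compE) (congr1 (fun f => f v) idE).
Unshelve. all: by end_near. Qed.

(** By linearity ['d phi] sends the velocity of the trailer system to that of the normal form with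
    the transformed controls. The chain rule through [phi] gives one direction, and through [psi]
    the other. *)
Lemma feedback_chart_trajectory J (zeta : R -> 'rV[R]_m.+1) (v1 v2 : R -> R) :
  open J -> (forall t, J t -> U (zeta t)) ->
  trajectory tau J zeta v1 v2 <->
  trajectory kappa J (phi \o zeta)
    (fun t => nu (zeta t) * v1 t + eta (zeta t) * v2 t)
    (fun t => mu (zeta t) * v2 t).
Proof.
move=> oJ JU.
have vE t : J t -> 'd phi (zeta t) (v1 t *: tau.1 (zeta t) +
  v2 t *: tau.2 (zeta t)) =
    (nu (zeta t) * v1 t + eta (zeta t) * v2 t) *: kappa.1 (phi (zeta t)) +
    (mu (zeta t) * v2 t) *: kappa.2 (phi (zeta t)).
  move=> Jt; rewrite linearD !linearZ /= (fc_push1 C (JU t Jt))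
    (fc_push2 C (JU t Jt)).
  by rewrite scalerDr !scalerA addrA -scalerDl; congr (_ *: _ + _ *: _); ring.
split=> H t Jt; have Uz := JU t Jt.
  rewrite /= -vE //; apply: is_derive_comp_curve (H t Jt) _.
  exact: smooth_differentiable (fc_smooth_phi C) Uz.
have := H t Jt; rewrite /= -vE // => D.
have := is_derive_comp_curve D (smooth_differentiable (fc_smooth_psi C)
  (fc_phi C Uz)).
rewrite /= diff_feedback_chartK //; apply: near_eq_is_derive.
(* As [J] is open, the curve stays in [U] for times near [t], where [psi \o phi \o zeta] is
   [zeta]. *)
near=> u; rewrite /= (fc_phiK C) //; apply: JU; near: u.
exact: open_nbhs_nbhs.
Unshelve. all: by end_near. Qed.

End ChartConsequences.

Theorem theorem3p1 (R : realType) (n : nat) (p : 'rV[R]_n.+3) :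
  let tau := trailer R n in
  let phi := nf_phi (nform p) in
  let mu := nf_mu (nform p) in
  let nu := nf_nu (nform p) in
  let eta := nf_eta (nform p) in
  [/\ smooth_at p mu, smooth_at p nu, smooth_at p eta,
      mu p != 0 /\ nu p != 0 & exists psi, local_inverse phi psi p] /\
  exists2 kappa : vfpair R n.+3, KumperaRuiz kappa &
    (forall psi, local_inverse phi psi p ->
       \forall x \near phi p,
         vf_push phi psi tau.1 x = nu (psi x) *: kappa.1 x /\
         vf_push phi psi tau.2 x =
           eta (psi x) *: kappa.1 x + mu (psi x) *: kappa.2 x) /\
    (exists2 W : set 'rV[R]_n.+3, open_nbhs p W &
       (forall z, W z -> nu z != 0 /\ mu z != 0) /\
       forall (J : set R) (zeta : R -> 'rV[R]_n.+3) (v1 v2 : R -> R),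
         open J -> (forall t, J t -> W (zeta t)) ->
         trajectory tau J zeta v1 v2 <->
         trajectory kappa J (phi \o zeta)
           (fun t => nu (zeta t) * v1 t + eta (zeta t) * v2 t)
           (fun t => mu (zeta t) * v2 t)).
Proof.
move=> tau phi mu nu eta.
have [kappa KR [psi [U [V [C Up]]]]] := nform_chart p.
have Unbhs : open_nbhs p U by split=> //; exact: fc_openU C.
split.
  split.
  - by exists U => //; exact: fc_smooth_mu C.
  - by exists U => //; exact: fc_smooth_nu C.
  - by exists U => //; exact: fc_smooth_eta C.
  - by split; [exact: (fc_mu_neq0 C)|exact: (fc_nu_neq0 C)].
  - by exists psi; exact: (feedback_chart_local_inverse C).
exists kappa => //; split; first by move=> psi'; exact: (feedback_chart_push C).
exists U => //; split.
  by move=> z Uz; split; [exact: (fc_nu_neq0 C)|exact: (fc_mu_neq0 C)].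
by move=> J zeta v1 v2; exact: (feedback_chart_trajectory C).
Qed.
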